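(* Let $S$ be a countable and discrete inverse semigroup generated by a symmetric set $K\subset S$, and suppose that $\Lambda(S,K)$ is of bounded geometry. The following statements are equivalent: (1) The pair $(S,K)$ admits a finite labeling. (2) The following C*-algebras are equal: $\mathcal{R}_S=\ell^{\infty}(S)\rtimes_r S=C^*_u(\Lambda(S,K))$. (Here $\mathcal{R}_S$ and $C_u^*(\Lambda(S,K))$ are both subalgebras of $\mathcal{B}(\ell^2(S))$, and $\ell^\infty(S)\rtimes_r S$ is identified with $\mathcal{R}_S$ via the canonical correspondence $\pi(f)(1\otimes V_s)\leftrightarrow fV_s$.)
   Context: An inverse semigroup is a non-empty set $S$ with an associative product such that for each $s\in S$ there is a unique $s^*\in S$ with $ss^*s=s$ and $s^*ss^*=s^*$. $S$ need not be unital or finitely generated. For $s\in S$ put $D_{s^*s}=\{x\in S: s^*sx=x\}$. Write $x\,\mathcal{L}\,y$ iff $x^*x=y^*y$; the equivalence classes are the $\mathcal{L}$-classes. A (countable) generating set $K\subset S$ is symmetric if $k\in K$ implies $k^*\in K$; generating means every element of $S$ is a finite product of elements of $K$. Graph: $\Lambda(S,K)$ has vertex set $S$, and $x,y\in S$ are joined by an edge labeled by $k\in K$ iff $x\,\mathcal{L}\,y$ and $kx=y$. It is regarded as undirected (if $x\,\mathcal L\,y$ and $kx=y$ then $k^*y=x$) and carries the path metric $d$, with $d=\infty$ between distinct connected components; it is thus an extended metric space. An extended metric space $X$ has bounded geometry if $\sup_{x\in X}|B_R(x)|<\infty$ for every $R>0$. Finite labeling: $(S,K)$ admits a finite labeling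 if there are $C\ge 1$ and a finite $K_1\subset K$ such that for all $x,y\in S$ with $x\,\mathcal{L}\,y$ and $y\in Kx$ one has $y\in K_1^p x$ for some $p\in\{1,\dots,C\}$, where $K_1^p$ is the set of (elements represented by) words of length $p$ in $K_1$. Algebras: $\ell^\infty(S)\subset\mathcal{B}(\ell^2(S))$ acts by diagonal operators; $\{\delta_x\}_{x\in S}$ is the canonical orthonormal basis of $\ell^2(S)$; $V_s\in\mathcal{B}(\ell^2(S))$ is given by $V_s\delta_x=\delta_{sx}$ if $x\in D_{s^*s}$ and $0$ otherwise. $\mathcal{R}_S$ is the C*-algebra generated by $\{fV_s: f\in\ell^\infty(S), s\in S\}$. For an extended metric space $X$ of bounded geometry, $T\in\mathcal{B}(\ell^2(X))$ has bounded propagation if $\sup\{d(x,y):\langle\delta_y,T\delta_x\rangle\ne 0\}<\infty$, and $C_u^*(X)$ is the C*-algebra generated by (i.e. the norm closure of) the $*$-algebra of operators of bounded propagation. Reduced crossed product: on $\ell^2(S)\otimes\ell^2(S)$ let $\pi(f)(\delta_x\otimes\delta_y)=f(yx)\,\delta_x\otimes\delta_y$ if $x\in D_{y^*y}$ and $0$ otherwise ($f\in\ell^\infty(S)$), and $(1\otimes V_s)(\delta_x\otimes\delta_y)=\delta_x\otimes\delta_{sy}$ if $y\in D_{s^*s}$ and $0$ otherwise. Then $\ell^\infty(S)\rtimes_r S\subset\mathcal{B}(\ell^2(S)\otimes\ell^2(S))$ is the C*-algebra generated by the products $\pi(f)(1\otimes V_s)$, $f\in\ell^\infty(S)$, $s\in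 S$.
   Formalization: The crossed product is matched with R_S by a *-homomorphism onto R_S sending π(f)(1⊗V_s) to fV_s, not required injective: fV_s ↦ π(f)(1⊗V_s) is ill-defined unless S is a group (e.g. S=K={0,1}: R_S=C², crossed product C³). *)

(* Defs.v *)
From HB Require Import structures.
From mathcomp Require Import all_boot all_order all_algebra.
From mathcomp Require Import all_classical all_reals all_analysis.
From mathcomp Require Import complex lra.

Set Implicit Arguments.
Unset Strict Implicit.
Unset Printing Implicit Defensive.

Import Order.TTheory GRing.Theory Num.Theory.
Import ComplexField.Normc.

Local Open Scope classical_set_scope.
Local Open Scope ring_scope.
Local Open Scope complex_scope.

HB.mixin Record isInverseSemigroup S of Semigroup S := {
  istar : S -> S;
  mulg_istarK : forall s : S, (s * istar s * s = s)%g;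
  istar_mulgK : forall s : S, (istar s * s * istar s = istar s)%g;
  istar_unique : forall s t : S,
    (s * t * s = s)%g -> (t * s * t = t)%g -> t = istar s;
  isg_inhabited : inhabited S
}.

#[short(type="inverseSemigroupType")]
HB.structure Definition InverseSemigroup :=
  { S of isInverseSemigroup S & Semigroup S }.

Section InverseSemigroups.
Variable S : inverseSemigroupType.
Implicit Types (s k x y : S) (K A : set S).

(* The set D_{s^* s}; membership only depends on the idempotent s^* s. *)
Definition Ddom s : set S := [set x | (istar s * s * x = x)%g].

Definition Lrel x y : Prop := (istar x * x = istar y * y)%g.

Definition symmetric_set K : Prop := forall k, K k -> K (istar k).

(* The elements represented by words of length p in A.  As S need not have a
   unit there is no empty word: [words A 0] is empty. *)
Definition words A (p : nat) : set S :=
  [set s | exists k (w : seq S),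
    [/\ forall a, a \in k :: w -> A a, size (k :: w) = p
      & s = foldl (fun u v => (u * v)%g) k w]].

Definition generates K : Prop := forall s, exists p, words K p s.

Definition edge K x y : Prop := Lrel x y /\ exists2 k, K k & (k * x = y)%g.

Fixpoint walk K (n : nat) x y : Prop :=
  if n is m.+1 then exists2 z, edge K x z & walk K m z y else x = y.

(* ereal_inf set0 = +oo, so the distance between two distinct connected
   components is infinite. *)
Definition path_dist (R : realType) K x y : \bar R :=
  ereal_inf [set (n%:R)%:E | n in [set n | walk K n x y]].

Definition finite_labeling K : Prop :=
  exists (C : nat) (K1 : set S),
    [/\ (1 <= C)%N, K1 `<=` K, finite_set K1 &
      forall x y, Lrel x y -> (exists2 k, K k & (k * x = y)%g) ->
        exists p, (1 <= p <= C)%N /\ exists2 w, words K1 p w & (w * x = y)%g].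

End InverseSemigroups.

Definition bounded_geometry (R : realType) (X : Type) (d : X -> X -> \bar R) :
    Prop :=
  forall r : R, 0 < r ->
    exists N : nat, forall x, ([set y | (d x y <= r%:E)%E] #<= `I_N)%card.

Section L2.
Variables (R : realType) (X : choiceType).
Implicit Types (f : X -> R[i]) (a : X -> R).

Definition sqnorm f : \bar R := \esum_(x in [set: X]) ((normc (f x) ^+ 2)%:E).

Definition sqsummable : {pred (X -> R[i])} := [pred f | `[< (sqnorm f < +oo)%E >]].

Lemma normc_sqrD (u v : R[i]) :
  normc (u + v) ^+ 2 <= 2 * normc u ^+ 2 + 2 * normc v ^+ 2.
Proof.
have n0 (w : R[i]) : 0 <= normc w by case: w => ? ?; exact: sqrtr_ge0.
have := le_normcD u v; have := n0 (u + v); have := n0 u; have := n0 v.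
move: (normc u) (normc v) (normc (u + v)) => a b c b0 a0 c0 cab.
have : c ^+ 2 <= (a + b) ^+ 2 by rewrite lerXn2r // nnegrE addr_ge0.
by have := sqr_ge0 (a - b); nra.
Qed.

Lemma sqsummable_submod : submod_closed sqsummable.
Proof.
have e0 (f : X -> R[i]) x : (0 <= ((normc (f x)) ^+ 2)%:E)%E.
  by rewrite lee_fin sqr_ge0.
have sZ (c : R) (f : X -> R[i]) : 0 <= c ->
    (\esum_(x in [set: X]) ((c * normc (f x) ^+ 2)%:E) <= c%:E * sqnorm f)%E.
  move=> c0; apply: ge_ereal_sup => _ [A [finA _] <-].
  under eq_fsbigr do rewrite EFinM.
  rewrite -ge0_mule_fsumr//; apply: lee_wpmul2l; first by rewrite lee_fin.
  by apply: ereal_sup_ubound; exists A.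
have fin (f : X -> R[i]) : (sqnorm f < +oo)%E -> sqnorm f \is a fin_num.
  by move=> h; rewrite ge0_fin_numE// esum_ge0.
have memP (f : X -> R[i]) : (sqnorm f < +oo)%E -> f \in sqsummable.
  by move=> h; rewrite unfold_in; apply: asboolT.
split.
  apply: memP; rewrite /sqnorm esum1 ?ltry// => x _.
  by have -> : (0 : X -> R[i]) x = 0 by []; rewrite normc0 expr0n.
have sfin (f : X -> R[i]) : f \in sqsummable -> (sqnorm f < +oo)%E.
  by rewrite unfold_in => /asboolP.
move=> c f g /sfin ff /sfin gf; apply: memP.
have h : (sqnorm (c *: f + g)%R <=
    (2 * normc c ^+ 2)%:E * sqnorm f + 2%:E * sqnorm g)%E.
  apply: (@le_trans _ _ (\esum_(x in [set: X])
      ((2 * normc c ^+ 2 * normc (f x) ^+ 2)%:E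
       + (2 * normc (g x) ^+ 2)%:E)%E)).
    apply: le_esum => x _; rewrite -EFinD lee_fin.
    apply: le_trans (normc_sqrD _ _) _.
    by rewrite normcM exprMn mulrA.
  rewrite esumD; last 2 first.
  - by move=> x _; rewrite lee_fin; do ?[exact: sqr_ge0|exact: ler0n|apply: mulr_ge0].
  - by move=> x _; rewrite lee_fin; do ?[exact: sqr_ge0|exact: ler0n|apply: mulr_ge0].
  by apply: leeD; apply: sZ; do ?[exact: sqr_ge0|exact: ler0n|apply: mulr_ge0].
apply: (le_lt_trans h).
by rewrite -(fineK (fin _ ff)) -(fineK (fin _ gf)) -!EFinM -EFinD ltry.
Qed.

HB.instance Definition _ :=
  GRing.isSubmodClosed.Build R[i] (X -> R[i]) sqsummable
    (GRing.submod_closed_semi sqsummable_submod).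

Record ell2 := Ell2 { ell2_fun :> X -> R[i]; _ : ell2_fun \in sqsummable }.

HB.instance Definition _ := [isSub for ell2_fun].
HB.instance Definition _ := gen_eqMixin ell2.
HB.instance Definition _ := gen_choiceMixin ell2.
HB.instance Definition _ := [SubChoice_isSubLmodule of ell2 by <:].

Lemma delta_subproof x :
  (fun y => (y == x)%:R : R[i]) \in sqsummable.
Proof.
rewrite unfold_in; apply: asboolT; rewrite /sqnorm.
rewrite (@eq_esum _ _ _ _ (fun y => if y \in [set x] then 1%E else 0%E)).
  by rewrite -esum_mkcond esum_set1 ?ltry// lee_fin.
move=> y _; have [->|yx] := eqVneq y x.
  by rewrite mem_set// normc1 expr1n.
by rewrite memNset ?normc0 ?expr0n//; apply/eqP.
Qed.

Definition delta x : ell2 := Ell2 (delta_subproof x).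

Definition l2norm (xi : ell2) : R := Num.sqrt (fine (sqnorm xi)).

(* Only meaningful on absolutely summable families, as is csum below. *)
Definition rsum a : R :=
  fine (\esum_(x in [set: X]) (Num.max (a x) 0)%:E)
  - fine (\esum_(x in [set: X]) (Num.max (- a x) 0)%:E).

Definition csum f : R[i] :=
  rsum (fun x => complex.Re (f x)) +i* rsum (fun x => complex.Im (f x)).

(* Linear in the second variable. *)
Definition inner (xi eta : ell2) : R[i] := csum (fun x => (xi x)^* * eta x).

End L2.

Notation op R X := (ell2 R X -> ell2 R X).

Section Operators.
Variables (R : realType) (X : choiceType).
Implicit Types (T U : op R X) (A G : set (op R X)) (f : X -> R[i]).

Definition bounded_op T : Prop :=
  linear T /\ exists M : R, forall xi, l2norm (T xi) <= M * l2norm xi.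

Definition adjoint T T' : Prop :=
  bounded_op T' /\ forall xi eta, inner (T xi) eta = inner xi (T' eta).

Definition opnorm_le T (e : R) : Prop :=
  forall xi, l2norm (T xi) <= e * l2norm xi.

Definition norm_closed A : Prop :=
  forall T, bounded_op T ->
    (forall e : R, 0 < e -> exists2 U, A U & opnorm_le (T - U) e) -> A T.

Definition cstar_subalgebra A : Prop :=
  [/\ A `<=` bounded_op, A 0,
      (forall T U, A T -> A U -> A (T + U) /\ A (T \o U)),
      (forall (c : R[i]) T, A T -> A (c *: T)) &
      (forall T T', A T -> adjoint T T' -> A T') /\ norm_closed A].

Definition cstar_generated G : set (op R X) := smallest cstar_subalgebra G.

Definition linfty f : Prop := exists M : R, forall x, normc (f x) <= M.

Definition diag_op f T : Prop :=
  bounded_op T /\ forall x, T (delta R x) = f x *: delta R x.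

Definition bounded_propagation (d : X -> X -> \bar R) T : Prop :=
  exists r : R, forall x y,
    inner (delta R y) (T (delta R x)) != 0 -> (d x y <= r%:E)%E.

Definition uniform_roe (d : X -> X -> \bar R) : set (op R X) :=
  cstar_generated [set T | bounded_op T /\ bounded_propagation d T].

End Operators.

Definition star_hom (R : realType) (X Y : choiceType) (A : set (op R X))
    (Phi : op R X -> op R Y) : Prop :=
  [/\ (forall T, A T -> bounded_op (Phi T)),
      (forall T U, A T -> A U -> Phi (T + U) = Phi T + Phi U),
      (forall (c : R[i]) T, A T -> Phi (c *: T) = c *: Phi T),
      (forall T U, A T -> A U -> Phi (T \o U) = Phi T \o Phi U) &
      (forall T T', A T -> adjoint T T' -> adjoint (Phi T) (Phi T'))].

Section SemigroupAlgebras.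
Variables (R : realType) (S : inverseSemigroupType).
Implicit Types (s x y : S) (f : S -> R[i]).

(* A bounded operator is determined by its values on an orthonormal basis. *)

Definition V_op s (V : op R S) : Prop :=
  bounded_op V /\ forall x, V (delta R x) =
    if x \in Ddom s then delta R (s * x)%g else 0.

(* l^2(S) (x) l^2(S) is l^2(S x S), with delta_x (x) delta_y = delta_(x, y). *)

Definition pi_op f (P : op R (S * S)%type) : Prop :=
  bounded_op P /\ forall x y, P (delta R (x, y)) =
    if x \in Ddom y then f (y * x)%g *: delta R (x, y) else 0.

Definition oneV_op s (W : op R (S * S)%type) : Prop :=
  bounded_op W /\ forall x y, W (delta R (x, y)) =
    if y \in Ddom s then delta R (x, (s * y)%g) else 0.

Definition RS : set (op R S) :=
  cstar_generated [set T | exists f s M V,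
    [/\ linfty f, diag_op f M, V_op s V & T = M \o V]].

Definition crossed_product : set (op R (S * S)%type) :=
  cstar_generated [set T | exists f s P W,
    [/\ linfty f, pi_op f P, oneV_op s W & T = P \o W]].

(* The correspondence pi(f)(1 (x) V_s) <-> f V_s, as the *-homomorphism that
   transports the crossed product into B(l^2(S)).  The direction matters: if
   e < e' are idempotents and f is the indicator of {e}, then f V_e = f V_e'
   whereas pi(f)(1 (x) V_e) and pi(f)(1 (x) V_e') differ at
   delta_e (x) delta_e'.  So f V_s |-> pi(f)(1 (x) V_s) is not a map, and Phi
   is not injective, unless S is a group. *)
Definition canonical_correspondence (Phi : op R (S * S)%type -> op R S) :
    Prop :=
  star_hom crossed_product Phi /\
  forall f s P W M V, linfty f -> pi_op f P -> oneV_op s W ->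
    diag_op f M -> V_op s V -> Phi (P \o W) = M \o V.

End SemigroupAlgebras.

Arguments RS : clear implicits.
Arguments crossed_product : clear implicits.

(* Main.v *)
Require Import Defs.
From mathcomp Require Import all_boot all_order all_algebra.
From mathcomp Require Import all_classical all_reals all_analysis.
From mathcomp Require Import complex ring lra.

Set Implicit Arguments.
Unset Strict Implicit.
Unset Printing Implicit Defensive.

Import Order.TTheory GRing.Theory Num.Theory.
Import numFieldNormedType.Exports.
Import ComplexField.Normc.
Local Open Scope classical_set_scope.

(** Write [R_S] for the algebra generated by the [f V_s].

    Finite labeling implies the equality of the Roe algebra and [R_S].  The
    operator [f V_s] always has bounded propagation: a word for [s], read from the
    right, is a walk from [x] to [s x] inside one L-class ([words_walk]).
    Conversely let [T] have propagation at most [r].  A finite labeling replaces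
    every walk of bounded length by one of finitely many elements [s] of the
    semigroup ([labeling_elements]), so each nonzero matrix entry of [T] lies on
    one of finitely many graphs [y = s x], and sorting the entries by [s] writes
    [T] as a finite sum of operators [f_s V_s] ([finite_graphs_RS]).

    Equality implies finite labeling.  Bounded geometry makes the adjacency matrix
    of the graph a bounded operator of propagation at most [1]
    ([exists_adjacency]).  If it belongs to [R_S], it is within [1 / 2] of an
    operator supported on finitely many graphs [y = s_i x] ([RS_controlled]).
    Every edge carries a matrix entry [1], hence is given by one of the [s_i], and
    the letters of words for the [s_i] form a finite labeling.

    The crossed product.  The vectors [delta (y^* y) (x) delta y] span a subspace
    that reduces the crossed product, and the compression [Phi] to it is a
    contractive star-homomorphism that sends [pi(f) (1 (x) V_s)] to [f V_s]
    ([exists_canonical_correspondence]).  It remains to see that its image is all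
    of [R_S], that is, that the image is norm closed ([image_norm_closed]).  As
    [Phi] is not injective, an element of the image with small norm must be shown
    to have a lift with small norm.  This is done without functional calculus:
    with [T' = T (1 + T^* T)^-1] the norm of [T'] is at most [1 / 2] for every
    [T], while [Phi T - Phi T'] has norm at most [1 / 2] as soon as [Phi T] is a
    contraction ([lift_unit]).  The resolvent is replaced by the partial sums of a
    Neumann series, and iterating the estimate gives a series of lifts that
    converges in the crossed product. *)

(** * Inverse semigroups, words and walks *)

Section InverseSemigroup.
Local Open Scope group_scope.
Variable S : inverseSemigroupType.
Implicit Types (e f s t x y : S) (K A : set S).

Lemma istarK s : istar (istar s) = s.
Proof. by apply/esym/istar_unique; rewrite ?mulg_istarK ?istar_mulgK. Qed.

Lemma istar_idem e : e * e = e -> istar e = e.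
Proof. by move=> ee; apply/esym/istar_unique; rewrite !ee. Qed.

(** With [x] the inverse of [e * f], the element [f * x * e] is an inverse too,
    so it is [x]; hence [x] is idempotent, and so is [e * f = istar x]. *)
Lemma idem_mul e f : e * e = e -> f * f = f -> e * f * (e * f) = e * f.
Proof.
move=> ee ff; set x := istar (e * f).
have xE : f * x * e = x.
  apply: istar_unique.
    rewrite -[RHS](mulg_istarK (e * f)) -/x !mulgA.
    by rewrite -(mulgA _ f f) ff -(mulgA _ e e) ee.
  rewrite !mulgA -(mulgA _ e e) ee -(mulgA _ f f) ff.
  have := istar_mulgK (e * f); rewrite -/x !mulgA => h.
  by rewrite -[in RHS]h !mulgA.
have xx : x * x = x.
  rewrite -[in LHS]xE !mulgA -[in RHS]xE.
  have := istar_mulgK (e * f); rewrite -/x !mulgA => h.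
  by rewrite -[in RHS]h !mulgA.
have : istar x = x by exact: istar_idem.
by rewrite /x istarK => ->.
Qed.

Lemma idem_comm e f : e * e = e -> f * f = f -> e * f = f * e.
Proof.
move=> ee ff.
have : f * e = istar (e * f).
  apply: istar_unique.
    by rewrite !mulgA -(mulgA _ f f) ff -(mulgA _ e e) ee -mulgA idem_mul.
  by rewrite !mulgA -(mulgA _ e e) ee -(mulgA _ f f) ff -mulgA idem_mul.
by rewrite istar_idem// idem_mul.
Qed.

Lemma idem_star_mul s : istar s * s * (istar s * s) = istar s * s.
Proof. by rewrite !mulgA istar_mulgK. Qed.

Lemma idem_mul_star s : s * istar s * (s * istar s) = s * istar s.
Proof. by rewrite !mulgA mulg_istarK. Qed.

Lemma domain_range_comm s t :
  istar s * s * (t * istar t) = t * istar t * (istar s * s).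
Proof. exact: idem_comm (idem_star_mul s) (idem_mul_star t). Qed.

Lemma istarM s t : istar (s * t) = istar t * istar s.
Proof.
apply/esym/istar_unique.
  have -> : s * t * (istar t * istar s) * (s * t)
    = s * (t * istar t * (istar s * s)) * t by rewrite !mulgA.
  rewrite -domain_range_comm -[in RHS](mulg_istarK s) -[in RHS](mulg_istarK t).
  by rewrite !mulgA.
have -> : istar t * istar s * (s * t) * (istar t * istar s)
  = istar t * (istar s * s * (t * istar t)) * istar s by rewrite !mulgA.
rewrite domain_range_comm -[in RHS](istar_mulgK s) -[in RHS](istar_mulgK t).
by rewrite !mulgA.
Qed.

Lemma DdomP s x : Ddom s x <-> istar s * (s * x) = x.
Proof. by rewrite /Ddom/= mulgA. Qed.

Lemma Ddom_star s x : Ddom s x -> Ddom (istar s) (s * x).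
Proof. by move=> /DdomP sx; apply/DdomP; rewrite istarK sx. Qed.

Lemma Ddom_Lrel s x : Ddom s x -> Lrel x (s * x).
Proof. by move=> /DdomP sx; rewrite /Lrel istarM -mulgA sx. Qed.

(** Conversely, [istar s * s] fixes [x] as soon as [s * x] has the same domain
    idempotent as [x], because it commutes with [x * istar x]. *)
Lemma Lrel_Ddom s x : Lrel x (s * x) -> Ddom s x.
Proof.
rewrite /Lrel istarM => h; rewrite /Ddom/=.
have -> : istar s * s * x = istar s * s * (x * istar x) * x.
  by rewrite -!mulgA (mulgA x) mulg_istarK.
rewrite domain_range_comm -(mulgA x) -(mulgA x) -(mulgA (istar x)).
rewrite -(mulgA _ s) (mulgA (istar x)) -h.
by rewrite mulgA mulg_istarK.
Qed.

Lemma DdomM s t x : Ddom (s * t) x <-> Ddom t x /\ Ddom s (t * x).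
Proof.
split=> [|[/DdomP tx /DdomP stx]]; last first.
  by apply/DdomP; rewrite istarM -mulgA -(mulgA s) stx.
move=> /DdomP; rewrite istarM => h; split; apply/DdomP.
  by rewrite -[in LHS]h !mulgA istar_mulgK -[RHS]h !mulgA.
rewrite -[in RHS]h.
have -> : t * (istar t * istar s * (s * t * x))
  = t * istar t * (istar s * s) * (t * x) by rewrite !mulgA.
rewrite -domain_range_comm -!mulgA; congr (_ * (_ * _)).
by rewrite !mulgA mulg_istarK.
Qed.

Lemma edge_sym K x y : symmetric_set K -> edge K x y -> edge K y x.
Proof.
move=> symK [xy [k Kk kxy]]; split; first exact: esym.
exists (istar k); first exact: symK.
by rewrite -kxy; apply/DdomP/Lrel_Ddom; rewrite kxy.
Qed.

Lemma walk_Lrel K n x y : walk K n x y -> Lrel x y.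
Proof.
elim: n x => [x ->|n IHn x [z [xz _] /IHn]]; first by [].
by rewrite /Lrel in xz *; rewrite xz.
Qed.

Lemma wordsM A p q s t : words A p s -> words A q t -> words A (p + q) (s * t).
Proof.
move=> [k [w [Aw <- ->]]] [l [v [Av <- ->]]].
exists k, (w ++ l :: v); split.
- move=> a; rewrite -cat_cons mem_cat => /orP[/Aw//|/Av//].
- by rewrite -cat_cons size_cat.
rewrite foldl_cat/=; move: (foldl _ k w) => {Aw}c.
elim/last_ind: v {Av} => [//|v b IHv].
by rewrite !foldl_rcons mulgA IHv.
Qed.

Lemma words_gt0 A p s : words A p s -> (0 < p)%N.
Proof. by move=> [k [w [_ <-]]]. Qed.

(** The suffixes of a word for [s] have larger domains than [s], so reading the
    word from right to left is a walk inside one L-class. *)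
Lemma words_walk A p s x : words A p s -> Ddom s x -> walk A p x (s * x).
Proof.
move=> [k [w [Aw <- ->]]].
elim/last_ind: w x Aw => [|w v IHw] x Aw.
  rewrite /= => kx; exists (k * x); last by [].
  split; first exact: Ddom_Lrel.
  by exists k => //; apply: Aw; rewrite mem_head.
rewrite foldl_rcons => /DdomM[vx wvx]; rewrite -rcons_cons size_rcons.
exists (v * x).
  split; first exact: Ddom_Lrel.
  by exists v => //; apply: Aw; rewrite -rcons_cons mem_rcons mem_head.
rewrite -mulgA; apply: IHw => // a awk.
by apply: Aw; rewrite -rcons_cons mem_rcons inE awk orbT.
Qed.

Lemma finite_words A p : finite_set A -> finite_set (words A p).
Proof.
move=> finA; elim: p => [|p IHp].
  by apply: (sub_finite_set _ (finite_set0 _)) => s /words_gt0.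
apply: (@sub_finite_set _ _
  (A `|` [set z.1 * z.2 | z in words A p `*` A])); last first.
  by rewrite finite_setU; split=> //; apply/finite_image/finite_setX.
move=> s [k [w [Aw]]].
case/lastP: w Aw => [|w v] Aw [szw] ->.
  by left; apply: Aw; rewrite mem_head.
right; exists (foldl (fun u v => u * v) k w, v); last by rewrite /= foldl_rcons.
split=> /=; last by apply: Aw; rewrite -rcons_cons mem_rcons mem_head.
exists k, w; split=> //.
  by move=> a aw; apply: Aw; rewrite -rcons_cons mem_rcons inE aw orbT.
by move: szw; rewrite size_rcons.
Qed.

End InverseSemigroup.

(** * Absolutely summable families *)

Section Sums.
Local Open Scope ring_scope.
Local Open Scope complex_scope.
Variables (R : realType) (X : choiceType).
Implicit Types (a b p q : X -> R) (f g : X -> R[i]).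

Definition abs_summable a : Prop :=
  (\esum_(x in [set: X]) (`|a x|)%:E < +oo)%E.

Lemma esum_fin a : (forall x, 0 <= a x) ->
  (\esum_(x in [set: X]) (a x)%:E < +oo)%E ->
  \esum_(x in [set: X]) (a x)%:E \is a fin_num.
Proof.
by move=> a0; rewrite ge0_fin_numE// esum_ge0// => x _; rewrite lee_fin.
Qed.

Lemma le_esum_lty a b : (forall x, a x <= b x) ->
  (\esum_(x in [set: X]) (b x)%:E < +oo)%E ->
  (\esum_(x in [set: X]) (a x)%:E < +oo)%E.
Proof.
by move=> ab; apply: le_lt_trans; apply: le_esum => x _; rewrite lee_fin.
Qed.

Lemma esum_EFinD a b : (forall x, 0 <= a x) -> (forall x, 0 <= b x) ->
  (\esum_(x in [set: X]) (a x + b x)%:E =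
   \esum_(x in [set: X]) (a x)%:E + \esum_(x in [set: X]) (b x)%:E)%E.
Proof.
by move=> a0 b0; rewrite -esumD// => x _; rewrite lee_fin.
Qed.

Lemma esumD_lty a b : (forall x, 0 <= a x) -> (forall x, 0 <= b x) ->
  (\esum_(x in [set: X]) (a x)%:E < +oo)%E ->
  (\esum_(x in [set: X]) (b x)%:E < +oo)%E ->
  (\esum_(x in [set: X]) (a x + b x)%:E < +oo)%E.
Proof. by move=> a0 b0 fa fb; rewrite esum_EFinD// lte_add_pinfty. Qed.

(** The value of [rsum] does not depend on how the family is written as a
    difference of two nonnegative summable ones. *)
Lemma rsum_sub p q : (forall x, 0 <= p x) -> (forall x, 0 <= q x) ->
  (\esum_(x in [set: X]) (p x)%:E < +oo)%E ->
  (\esum_(x in [set: X]) (q x)%:E < +oo)%E ->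
  rsum (fun x => p x - q x) =
    fine (\esum_(x in [set: X]) (p x)%:E) - fine (\esum_(x in [set: X]) (q x)%:E).
Proof.
move=> p0 q0 fp fq; rewrite /rsum.
set P := fun x => Num.max (p x - q x) 0; set Q := fun x => Num.max (- (p x - q x)) 0.
have P0 x : 0 <= P x by rewrite le_max lexx orbT.
have Q0 x : 0 <= Q x by rewrite le_max lexx orbT.
have fP : (\esum_(x in [set: X]) (P x)%:E < +oo)%E.
  by apply: le_esum_lty fp => x; rewrite ge_max p0 andbT gerBl.
have fQ : (\esum_(x in [set: X]) (Q x)%:E < +oo)%E.
  by apply: le_esum_lty fq => x; rewrite ge_max q0 andbT opprB gerBl.
have : (\esum_(x in [set: X]) (P x)%:E + \esum_(x in [set: X]) (q x)%:E =
        \esum_(x in [set: X]) (Q x)%:E + \esum_(x in [set: X]) (p x)%:E)%E.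
  rewrite -!esumD; do ?by move=> x _; rewrite lee_fin.
  apply: eq_esum => x _; rewrite -!EFinD /P /Q /Num.max; congr (_%:E).
  by do 2 case: ifPn; rewrite -?leNgt; lra.
move=> /(congr1 fine); rewrite !fineD ?esum_fin// /P /Q; lra.
Qed.

Let max_sub a x : Num.max (a x) 0 - Num.max (- a x) 0 = a x.
Proof. by rewrite /Num.max; do 2 case: ifPn; rewrite -?leNgt; lra. Qed.

Let max0 (r : R) : 0 <= Num.max r 0.
Proof. by rewrite le_max lexx orbT. Qed.

Let summable_pos a : abs_summable a ->
  (\esum_(x in [set: X]) (Num.max (a x) 0)%:E < +oo)%E.
Proof.
by apply: le_esum_lty => x; rewrite ge_max normr_ge0 andbT ler_norm.
Qed.

Let summable_neg a : abs_summable a ->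
  (\esum_(x in [set: X]) (Num.max (- a x) 0)%:E < +oo)%E.
Proof.
by apply: le_esum_lty => x; rewrite ge_max normr_ge0 andbT -normrN ler_norm.
Qed.

Lemma rsumD a b : abs_summable a -> abs_summable b ->
  rsum (fun x => a x + b x) = rsum a + rsum b.
Proof.
move=> fa fb; have [pa pb] := (summable_pos fa, summable_pos fb).
have [na nb] := (summable_neg fa, summable_neg fb).
have -> : (fun x => a x + b x) =
    (fun x => (Num.max (a x) 0 + Num.max (b x) 0)
              - (Num.max (- a x) 0 + Num.max (- b x) 0)).
  by apply/funext => x; rewrite -{1}(max_sub a x) -{1}(max_sub b x); lra.
rewrite rsum_sub; do ?by [move=> x; exact: addr_ge0|exact: esumD_lty].
rewrite !esum_EFinD//.
rewrite /rsum !fineD ?esum_fin//; lra.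
Qed.

Lemma rsumN a : rsum (fun x => - a x) = - rsum a.
Proof.
rewrite /rsum opprB; congr (_ - fine _).
by apply: eq_esum => x _; rewrite opprK.
Qed.

Lemma ge0_esumZ (c : R) a : 0 <= c -> (forall x, 0 <= a x) ->
  \esum_(x in [set: X]) (c * a x)%:E = (c%:E * \esum_(x in [set: X]) (a x)%:E)%E.
Proof.
move=> c0 a0.
have le_scale (d : R) b : 0 <= d -> (forall x, 0 <= b x) ->
    (\esum_(x in [set: X]) (d * b x)%:E <= d%:E * \esum_(x in [set: X]) (b x)%:E)%E.
  move=> d0 b0; apply: ge_ereal_sup => _ [A [finA _] <-].
  under eq_fsbigr do rewrite EFinM.
  rewrite -ge0_mule_fsumr//.
  apply: lee_wpmul2l; first by rewrite lee_fin.
  by apply: ereal_sup_ubound; exists A.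
apply/eqP; rewrite eq_le le_scale//=.
have [cz|cz] := eqVneq c 0.
  by rewrite cz mul0e esum_ge0// => x _; rewrite mul0r.
have {}c0 : 0 < c by rewrite lt_def cz.
have := le_scale c^-1 (fun x => c * a x).
rewrite invr_ge0 ltW// => /(_ isT (fun x => mulr_ge0 (ltW c0) (a0 x))).
under eq_esum do rewrite mulrA mulVf// mul1r.
move=> /(lee_wpmul2l (x := c%:E)); rewrite lee_fin ltW// => /(_ isT).
by rewrite muleA -EFinM divff// mul1e.
Qed.

Lemma abs_summableZ (c : R) a : abs_summable a -> abs_summable (fun x => c * a x).
Proof.
move=> fa; rewrite /abs_summable; under eq_esum do rewrite normrM.
by rewrite ge0_esumZ// -(fineK (esum_fin _ fa))// -EFinM ltry.
Qed.

Lemma rsumZ (c : R) a : abs_summable a -> rsum (fun x => c * a x) = c * rsum a.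
Proof.
move=> fa; have [pa na] := (summable_pos fa, summable_neg fa).
wlog c0 : c / 0 <= c.
  move=> pos; case: (leP 0 c) => c0; first exact: pos.
  have := pos (- c); rewrite oppr_ge0 ltW// => /(_ isT).
  have -> : (fun x => - c * a x) = (fun x => - (c * a x)).
    by apply/funext => x; rewrite mulNr.
  by rewrite rsumN mulNr => /oppr_inj.
have -> : (fun x => c * a x) =
    (fun x => c * Num.max (a x) 0 - c * Num.max (- a x) 0).
  by apply/funext => x; rewrite -mulrBr max_sub.
have lt_scale b : (forall x, 0 <= b x) ->
    (\esum_(x in [set: X]) (b x)%:E < +oo)%E ->
    (\esum_(x in [set: X]) (c * b x)%:E < +oo)%E.
  by move=> b0 fb; rewrite ge0_esumZ// -(fineK (esum_fin _ fb))// -EFinM ltry.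
rewrite rsum_sub; do ?by [move=> x; exact: mulr_ge0|exact: lt_scale].
by rewrite !ge0_esumZ// !fineM ?esum_fin// mulrBr.
Qed.

Lemma ge0_rsum a : (forall x, 0 <= a x) ->
  rsum a = fine (\esum_(x in [set: X]) (a x)%:E).
Proof.
move=> a0; rewrite /rsum [X in _ - fine X]esum1 ?subr0.
  by congr fine; apply: eq_esum => x _; rewrite max_l.
by move=> x _; rewrite max_r// oppr_le0.
Qed.

Lemma rsum_point x0 a : (forall x, x != x0 -> a x = 0) -> rsum a = a x0.
Proof.
have pt b : (forall x, 0 <= b x) -> (forall x, x != x0 -> b x = 0) ->
    \esum_(x in [set: X]) (b x)%:E = (b x0)%:E.
  move=> b0 bx; rewrite -(@esum_set1 _ _ x0 (fun x => (b x)%:E)) ?lee_fin//.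
  rewrite [RHS]esum_mkcond; apply: eq_esum => x _.
  have [->|xx] := eqVneq x x0; first by rewrite mem_set.
  by rewrite memNset ?bx//; exact/eqP.
move=> ax; rewrite /rsum !pt//= ?max_sub// => x /ax->.
  by rewrite oppr0 max_l.
by rewrite max_l.
Qed.

Definition csummable f : Prop :=
  abs_summable (fun x => complex.Re (f x)) /\ abs_summable (fun x => complex.Im (f x)).

Lemma csumD f g : csummable f -> csummable g ->
  csum (fun x => f x + g x) = csum f + csum g.
Proof.
move=> [Rf If] [Rg Ig]; rewrite /csum.
have -> : (fun x => complex.Re (f x + g x))
    = (fun x => complex.Re (f x) + complex.Re (g x)).
  by apply/funext => x; case: (f x) (g x) => ? ? [].
have -> : (fun x => complex.Im (f x + g x))
    = (fun x => complex.Im (f x) + complex.Im (g x)).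
  by apply/funext => x; case: (f x) (g x) => ? ? [].
by rewrite !rsumD.
Qed.

Lemma csumZ (c : R[i]) f : csummable f -> csum (fun x => c * f x) = c * csum f.
Proof.
move=> [Rf If]; rewrite /csum; case: c => a b.
have -> : (fun x => complex.Re ((a +i* b) * f x))
    = (fun x => a * complex.Re (f x) + (- b) * complex.Im (f x)).
  by apply/funext => x; case: (f x) => ? ?; rewrite /= mulNr.
have -> : (fun x => complex.Im ((a +i* b) * f x))
    = (fun x => a * complex.Im (f x) + b * complex.Re (f x)).
  by apply/funext => x; case: (f x) => ? ?; rewrite /= [b * _]mulrC.
rewrite !rsumD; do ?exact: abs_summableZ.
by rewrite !rsumZ// mulNr.
Qed.

Lemma csum_conj f : csum (fun x => (f x)^*) = (csum f)^*.
Proof.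
rewrite /csum/= -rsumN; congr Complex; congr rsum; apply/funext => x;
  by case: (f x).
Qed.

Lemma csum_point x0 f : (forall x, x != x0 -> f x = 0) -> csum f = f x0.
Proof.
move=> fx; rewrite /csum !(@rsum_point x0); first by case: (f x0).
  by move=> x /fx->.
by move=> x /fx->.
Qed.

Lemma normc_ge0 (z : R[i]) : 0 <= normc z.
Proof. by case: z => ? ?; exact: sqrtr_ge0. Qed.

Lemma normc_sqr (z : R[i]) : normc z ^+ 2 = complex.Re z ^+ 2 + complex.Im z ^+ 2.
Proof. by case: z => ? ?; rewrite sqr_sqrtr// addr_ge0// sqr_ge0. Qed.

End Sums.

(** * Square summable families *)

Section NormC.
Local Open Scope ring_scope.
Local Open Scope complex_scope.
Variable R : realType.
Implicit Types (y z : R[i]).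

Lemma normc_ge_Re z : `|complex.Re z| <= normc z.
Proof.
rewrite -(@ler_pXn2r _ 2)// ?nnegrE ?normr_ge0 ?normc_ge0//.
by rewrite normc_sqr real_normK ?num_real// lerDl sqr_ge0.
Qed.

Lemma normc_ge_Im z : `|complex.Im z| <= normc z.
Proof.
rewrite -(@ler_pXn2r _ 2)// ?nnegrE ?normr_ge0 ?normc_ge0//.
by rewrite normc_sqr real_normK ?num_real// lerDr sqr_ge0.
Qed.

Lemma normc_Re_sub y z : `|complex.Re y - complex.Re z| <= normc (y - z).
Proof. by apply: le_trans (normc_ge_Re _); case: y z => ? ? []. Qed.

Lemma normc_Im_sub y z : `|complex.Im y - complex.Im z| <= normc (y - z).
Proof. by apply: le_trans (normc_ge_Im _); case: y z => ? ? []. Qed.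

Lemma normc_le_sum z : normc z <= `|complex.Re z| + `|complex.Im z|.
Proof.
rewrite -(@ler_pXn2r _ 2)// ?nnegrE ?normc_ge0 ?addr_ge0//.
rewrite normc_sqr -(real_normK (num_real (complex.Re z))).
rewrite -(real_normK (num_real (complex.Im z))).
by have := mulr_ge0 (normr_ge0 (complex.Re z)) (normr_ge0 (complex.Im z)); nra.
Qed.

End NormC.

Section HilbertSpace.
Local Open Scope ring_scope.
Local Open Scope complex_scope.
Variables (R : realType) (X : choiceType).
Implicit Types (u v w : ell2 R X) (c : R[i]) (r : R) (x y : X).

Lemma ell2P u v : (forall x, u x = v x) -> u = v.
Proof. by move=> uv; apply: val_inj; apply/funext. Qed.

Lemma ell2D u v x : (u + v) x = u x + v x.
Proof. by []. Qed.

Lemma ell2Z c u x : (c *: u) x = c * u x.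
Proof. by []. Qed.

Lemma ell20 x : (0 : ell2 R X) x = 0.
Proof. by []. Qed.

Lemma sqnorm_lty u : (sqnorm u < +oo)%E.
Proof. by case: u => f /=; rewrite unfold_in => /asboolP. Qed.

Lemma l2norm_ge0 u : 0 <= l2norm u.
Proof. exact: sqrtr_ge0. Qed.

Lemma l2norm_sqr u : l2norm u ^+ 2 = fine (sqnorm u).
Proof.
by rewrite sqr_sqrtr// fine_ge0// esum_ge0// => x _; rewrite lee_fin sqr_ge0.
Qed.

Lemma le_sqnorm (f : X -> R[i]) r :
  (forall s : seq X, uniq s -> \sum_(x <- s) normc (f x) ^+ 2 <= r) ->
  (sqnorm f <= r%:E)%E.
Proof.
move=> fr; apply: ge_ereal_sup => _ [A [finA _] <-].
by rewrite fsbig_finite//= sumEFin lee_fin; apply: fr; exact: finmap.fset_uniq.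
Qed.

Lemma ell2_bound (f : X -> R[i]) r : 0 <= r ->
  (forall s : seq X, uniq s -> \sum_(x <- s) normc (f x) ^+ 2 <= r ^+ 2) ->
  {u : ell2 R X | ell2_fun u = f & l2norm u <= r}.
Proof.
move=> r0 /le_sqnorm fr.
have fs : f \in @sqsummable R X.
  by rewrite unfold_in; apply/asboolP/(le_lt_trans fr); rewrite ltry.
exists (Ell2 fs) => //.
rewrite -(@ler_pXn2r _ 2)// ?nnegrE ?l2norm_ge0// l2norm_sqr.
by rewrite -lee_fin fineK// ge0_fin_numE ?sqnorm_lty// esum_ge0// => x _;
  rewrite lee_fin sqr_ge0.
Qed.

Lemma sum_le_l2norm u (s : seq X) : uniq s ->
  \sum_(x <- s) normc (u x) ^+ 2 <= l2norm u ^+ 2.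
Proof.
move=> us; rewrite l2norm_sqr -lee_fin fineK; last first.
  by rewrite ge0_fin_numE ?sqnorm_lty// esum_ge0// => x _; rewrite lee_fin sqr_ge0.
rewrite -sumEFin; apply: esum_ge; exists [set` s]; first by split.
by rewrite (fsbig_seq _ _ us).
Qed.

Lemma coord_le_l2norm u x : normc (u x) <= l2norm u.
Proof.
rewrite -(@ler_pXn2r _ 2)// ?nnegrE ?l2norm_ge0 ?normc_ge0//.
by have := @sum_le_l2norm u [:: x] isT; rewrite big_seq1.
Qed.

Lemma l2norm_eq0 u : l2norm u = 0 -> u = 0.
Proof.
move=> u0; apply: ell2P => x; rewrite ell20; apply/eq0_normc/eqP.
by rewrite eq_le normc_ge0 andbT -u0 coord_le_l2norm.
Qed.

Lemma inner_summable u v : csummable (fun x => Num.conj (u x) * v x).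
Proof.
have sum2 : (\esum_(x in [set: X])
    (normc (u x) ^+ 2 + normc (v x) ^+ 2)%:E < +oo)%E.
  by apply: esumD_lty; do ?[by move=> x; exact: sqr_ge0|exact: sqnorm_lty].
split; apply: le_esum_lty sum2 => x; rewrite !normc_sqr ler_norml;
  case: (u x) (v x) => a b [d e] /=;
  have := (sqr_ge0 (a + d), sqr_ge0 (a - d), sqr_ge0 (b - e), sqr_ge0 (b + e),
           sqr_ge0 (a - e), sqr_ge0 (a + e), sqr_ge0 (b - d), sqr_ge0 (b + d));
  rewrite !sqrrD !sqrrN => -[[[[[[[]]]]]]] *; apply/andP; split; nra.
Qed.

Lemma innerDr u v w : inner u (v + w) = inner u v + inner u w.
Proof.
rewrite /inner -csumD; try exact: inner_summable.
by congr csum; apply/funext => x; rewrite ell2D mulrDr.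
Qed.

Lemma innerZr c u v : inner u (c *: v) = c * inner u v.
Proof.
rewrite /inner -csumZ; last exact: inner_summable.
by congr csum; apply/funext => x; rewrite ell2Z mulrCA.
Qed.

Lemma innerC u v : inner v u = Num.conj (inner u v).
Proof.
rewrite /inner -[RHS]/((csum _)^*) -csum_conj; congr csum; apply/funext => x.
by rewrite -[RHS]/(Num.conj _) rmorphM/= conjCK mulrC.
Qed.

Lemma innerDl u v w : inner (u + v) w = inner u w + inner v w.
Proof. by rewrite innerC innerDr rmorphD/= -!innerC. Qed.

Lemma innerZl c u v : inner (c *: u) v = Num.conj c * inner u v.
Proof. by rewrite innerC innerZr rmorphM/= -innerC. Qed.

Lemma innerNr u v : inner u (- v) = - inner u v.
Proof. by rewrite -scaleN1r innerZr mulN1r. Qed.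

Lemma innerNl u v : inner (- u) v = - inner u v.
Proof. by rewrite innerC innerNr rmorphN/= -innerC. Qed.

Lemma innerBr u v w : inner u (v - w) = inner u v - inner u w.
Proof. by rewrite innerDr innerNr. Qed.

Lemma innerBl u v w : inner (u - v) w = inner u w - inner v w.
Proof. by rewrite innerDl innerNl. Qed.

Lemma inner0r u : inner u 0 = 0.
Proof. by rewrite -(scale0r (0 : ell2 R X)) innerZr mul0r. Qed.

Lemma inner0l u : inner 0 u = 0.
Proof. by rewrite innerC inner0r conjC0. Qed.

Lemma inner_self u : inner u u = (l2norm u ^+ 2)%:C.
Proof.
rewrite l2norm_sqr /inner /csum /real_complex_def; congr (Complex _ _).
  rewrite ge0_rsum => [|x].
    congr fine; apply: eq_esum => x _; congr _%:E.
    by rewrite normc_sqr; case: (u x) => a b /=; rewrite mulNr opprK !expr2.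
  by case: (u x) => a b /=; rewrite mulNr opprK -!expr2 addr_ge0 ?sqr_ge0.
have -> : (fun x => complex.Im (Num.conj (u x) * u x)) = (fun=> 0).
  by apply/funext => x; case: (u x) => a b /=; rewrite mulNr mulrC subrr.
by rewrite ge0_rsum// esum1.
Qed.

Lemma inner_delta x u : inner (delta R x) u = u x.
Proof.
rewrite /inner (csum_point (x0 := x)) /=.
  by rewrite eqxx conjC1 mul1r.
by move=> y /negbTE yx; rewrite yx conjC0 mul0r.
Qed.

Lemma deltaE x y : delta R x y = (y == x)%:R.
Proof. by []. Qed.

Lemma l2norm_sqrD u v :
  l2norm (u + v) ^+ 2 = l2norm u ^+ 2 + 2 * complex.Re (inner u v) + l2norm v ^+ 2.
Proof.
have := inner_self (u + v); rewrite innerDl !innerDr !inner_self (innerC u v).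
move=> /(congr1 (@complex.Re R)); case: (inner u v) => a b /= <-; ring.
Qed.

Lemma l2norm0 : l2norm (0 : ell2 R X) = 0.
Proof.
by apply/eqP; rewrite -sqrf_eq0; have [->] : (l2norm (0 : ell2 R X) ^+ 2)%:C = 0
  by rewrite -inner_self inner0r.
Qed.

Lemma l2normZ c u : l2norm (c *: u) = normc c * l2norm u.
Proof.
apply/eqP; rewrite -(@eqrXn2 _ 2)// ?mulr_ge0 ?l2norm_ge0 ?normc_ge0//.
have := inner_self (c *: u); rewrite innerZl innerZr inner_self exprMn.
move=> /(congr1 (@complex.Re R)); rewrite normc_sqr; case: c => a b /= <-.
by apply/eqP; ring.
Qed.

Lemma l2normN u : l2norm (- u) = l2norm u.
Proof. by rewrite -scaleN1r l2normZ normcN normc1 mul1r. Qed.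

Lemma conj_real r : Num.conj r%:C = r%:C.
Proof. exact: conjc_real. Qed.

Lemma Re_realM r c : complex.Re (r%:C * c) = r * complex.Re c.
Proof. by case: c => a b /=; rewrite mul0r subr0. Qed.

Lemma ReN c : complex.Re (- c) = - complex.Re c.
Proof. by case: c. Qed.

Lemma normc_real r : 0 <= r -> normc r%:C = r.
Proof. by move=> r0; rewrite /= expr0n addr0 sqrtr_sqr ger0_norm. Qed.

Lemma cauchy_schwarz u v : complex.Re (inner u v) <= l2norm u * l2norm v.
Proof.
have [/l2norm_eq0->|u0] := eqVneq (l2norm u) 0.
  by rewrite inner0l/= mulr_ge0 ?l2norm_ge0.
have [/l2norm_eq0->|v0] := eqVneq (l2norm v) 0.
  by rewrite inner0r/= mulr_ge0 ?l2norm_ge0.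
have lu : 0 < l2norm u by rewrite lt_def u0 l2norm_ge0.
have lv : 0 < l2norm v by rewrite lt_def v0 l2norm_ge0.
have := l2norm_sqrD ((l2norm v)%:C *: u) (- ((l2norm u)%:C *: v)).
rewrite l2normN !l2normZ innerNr innerZl innerZr conj_real.
rewrite !normc_real ?l2norm_ge0// ReN !Re_realM => E.
have : 0 <= l2norm ((l2norm v)%:C *: u - (l2norm u)%:C *: v) ^+ 2 by exact: sqr_ge0.
rewrite E => h; rewrite -(ler_pM2l (mulr_gt0 lu lv)); nra.
Qed.

Lemma ler_l2normD u v : l2norm (u + v) <= l2norm u + l2norm v.
Proof.
rewrite -(@ler_pXn2r _ 2)// ?nnegrE ?addr_ge0 ?l2norm_ge0// l2norm_sqrD.
by have := cauchy_schwarz u v; nra.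
Qed.

Lemma ler_l2norm_sum (I : Type) (s : seq I) (F : I -> ell2 R X) :
  l2norm (\sum_(i <- s) F i) <= \sum_(i <- s) l2norm (F i).
Proof.
elim: s => [|i s IHs]; first by rewrite !big_nil l2norm0.
by rewrite !big_cons (le_trans (ler_l2normD _ _))// lerD2l.
Qed.

Lemma inner_suml (I : Type) (s : seq I) u (F : I -> ell2 R X) :
  inner (\sum_(i <- s) F i) u = \sum_(i <- s) inner (F i) u.
Proof.
by elim: s => [|i s IHs]; rewrite ?big_nil ?inner0l// !big_cons innerDl IHs.
Qed.

Lemma ell2_sum (I : Type) (s : seq I) (F : I -> ell2 R X) x :
  (\sum_(i <- s) F i) x = \sum_(i <- s) F i x.
Proof. by elim: s => [|i s IHs]; rewrite ?big_nil// !big_cons ell2D IHs. Qed.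

Lemma inner_eq0 u : (forall v, inner u v = 0) -> u = 0.
Proof. by move=> u0; apply: ell2P => x; rewrite -inner_delta innerC u0 conjC0. Qed.

Definition truncate u (s : seq X) : ell2 R X := \sum_(x <- s) u x *: delta R x.

Lemma truncateE u s y : uniq s -> truncate u s y = if y \in s then u y else 0.
Proof.
move=> us; rewrite ell2_sum; under eq_bigr do rewrite ell2Z deltaE.
case: ifPn => [ys|ys].
  rewrite (bigD1_seq y)//= eqxx mulr1 big1 ?addr0// => x /negbTE xy.
  by rewrite eq_sym xy mulr0.
rewrite big_seq big1// => x xs; case: eqP => [yx|]; last by rewrite mulr0.
by rewrite -yx (negbTE ys) in (xs).
Qed.

Lemma truncate_dense u (e : R) : 0 < e ->
  exists2 s : seq X, uniq s & l2norm (u - truncate u s) <= e.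
Proof.
move=> e0; have e20 : 0 < e ^+ 2 by exact: exprn_gt0.
have usup : (sqnorm u - (e ^+ 2)%:E < sqnorm u)%E.
  rewrite lteBlDr// lteDl// ?lte_fin// ge0_fin_numE ?sqnorm_lty//.
  by rewrite esum_ge0// => x _; rewrite lee_fin sqr_ge0.
have [_ [A [finA _] <-]] := ereal_sup_gt usup.
rewrite fsbig_finite//= sumEFin => Au.
set s : seq X := finmap.enum_fset (fset_set A) in Au.
have us : uniq s by exact: finmap.fset_uniq.
exists s => //.
have [|w wE wr] := @ell2_bound (u - truncate u s : ell2 R X) e (ltW e0); last first.
  by rewrite (_ : _ - _ = w)//; apply: ell2P => x; rewrite wE.
move=> t ut; apply: (@le_trans _ _ (\sum_(x <- [seq x <- t | x \notin s])
    normc (u x) ^+ 2)).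
  rewrite big_filter [leRHS]big_mkcond/=; apply: ler_sum => x _.
  rewrite -[_ x]/(u x - truncate u s x) truncateE//; case: ifPn => /= xs.
    by rewrite subrr normc0 expr0n.
  by rewrite subr0.
have ust : uniq (s ++ [seq x <- t | x \notin s]).
  rewrite cat_uniq us filter_uniq// andbT/=.
  by apply/hasPn => x; rewrite mem_filter => /andP[].
have := sum_le_l2norm u ust; rewrite big_cat/= l2norm_sqr => le_u.
move: Au; rewrite -(@fineK _ (sqnorm u)); last first.
  rewrite ge0_fin_numE ?sqnorm_lty// esum_ge0// => x _.
  by rewrite lee_fin sqr_ge0.
by rewrite -EFinB lte_fin; move: le_u; lra.
Qed.

Lemma truncateB u v s : truncate (u - v) s = truncate u s - truncate v s.
Proof.
rewrite /truncate -sumrB; apply: eq_bigr => x _.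
by rewrite -scalerBl.
Qed.

Lemma l2norm_truncate u s : uniq s -> l2norm (truncate u s) <= l2norm u.
Proof.
move=> us; have [|w wE wr] := @ell2_bound (truncate u s) (l2norm u) (l2norm_ge0 u).
  move=> t ut; apply: le_trans (sum_le_l2norm u ut).
  apply: ler_sum => x _; rewrite truncateE//; case: ifP => // _.
  by rewrite normc0 expr0n sqr_ge0.
by rewrite (_ : truncate u s = w)//; apply: ell2P => x; rewrite wE.
Qed.

Lemma l2norm_delta x : l2norm (delta R x) = 1.
Proof.
have := inner_self (delta R x); rewrite inner_delta deltaE eqxx => -[] /esym/eqP.
by rewrite sqrf_eq1 => /orP[/eqP->//|/eqP h]; have := l2norm_ge0 (delta R x); lra.
Qed.

End HilbertSpace.

Section Completeness.
Local Open Scope ring_scope.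
Local Open Scope complex_scope.
Variables (R : realType) (X : choiceType).
Implicit Types (e : nat -> R).

Lemma real_complete (a e : nat -> R) :
  (forall n m, (n <= m)%N -> `|a m - a n| <= e n) ->
  exists l, forall n, `|l - a n| <= e n.
Proof.
move=> ae; pose A := [set a n - e n | n in [set: nat]].
have leA n m : a n - e n <= a m + e m.
  have := ae _ _ (leq_maxl n m); have := ae _ _ (leq_maxr n m).
  by rewrite !ler_norml => /andP[? ?] /andP[? ?]; lra.
exists (sup A) => n; rewrite ler_distl; apply/andP; split.
  apply: ub_le_sup; last by exists n.
  by exists (a n + e n) => _ [m _ <-].
by apply: ge_sup => [|_ [m _ <-]//]; exists (a 0%N - e 0%N), 0%N.
Qed.

(** The coordinatewise limit [v] is the limit in norm: on finitely many
    coordinates the distance from [u n] to [v] is at most [e n] up to an error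
    that tends to [0]. *)
Lemma l2_complete (u : nat -> ell2 R X) e :
  (forall n m, (n <= m)%N -> l2norm (u m - u n) <= e n) ->
  (forall r : R, 0 < r -> exists n0, forall n, (n0 <= n)%N -> e n <= r) ->
  exists v, forall n, l2norm (v - u n) <= e n.
Proof.
move=> ue e0.
have coord x : exists z : R[i], forall n, normc (z - u n x) <= 2 * e n.
  have [|re reP] := @real_complete (fun n => complex.Re (u n x)) e.
    move=> n m nm; apply: le_trans (ue n m nm).
    exact: le_trans (normc_Re_sub _ _) (coord_le_l2norm (u m - u n) x).
  have [|im imP] := @real_complete (fun n => complex.Im (u n x)) e.
    move=> n m nm; apply: le_trans (ue n m nm).
    exact: le_trans (normc_Im_sub _ _) (coord_le_l2norm (u m - u n) x).
  exists (re +i* im) => n; apply: le_trans (normc_le_sum _) _.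
  have := lerD (reP n) (imP n); case: (u n x) => a b /=; lra.
have e_ge0 n : 0 <= e n := le_trans (l2norm_ge0 _) (ue n n (leqnn n)).
have [v vP] := choice coord.
have vu n : {w : ell2 R X | ell2_fun w = (fun x => v x - u n x) & l2norm w <= e n}.
  apply: ell2_bound => // s us.
  pose V : ell2 R X := \sum_(x <- s) v x *: delta R x.
  have VE (m : nat) : l2norm (V - truncate (u m) s) <= (size s)%:R * (2 * e m).
    rewrite -sumrB; apply: (le_trans (ler_l2norm_sum _ _)).
    rewrite -sum1_size natr_sum mulr_suml; apply: ler_sum => x _.
    by rewrite -scalerBl l2normZ l2norm_delta mulr1 mul1r.
  have Vn : l2norm (V - truncate (u n) s) <= e n.
    apply/ler_addgt0Pr => r r0.
    have r'0 : 0 < r / ((size s).+1%:R * 2) by rewrite divr_gt0// mulr_gt0.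
    have [n0 /(_ _ (leq_maxl n0 n)) em] := e0 _ r'0; set m := maxn n0 n in em.
    have -> : V - truncate (u n) s
      = truncate (u m - u n) s + (V - truncate (u m) s).
      by rewrite truncateB [RHS]addrC addrA subrK.
    apply: (le_trans (ler_l2normD _ _)); apply: lerD.
      exact: le_trans (l2norm_truncate _ us) (ue _ _ (leq_maxr _ _)).
    apply: le_trans (VE m) _.
    move: em; rewrite ler_pdivlMr ?mulr_gt0// -natr1.
    by have := e_ge0 m; nra.
  have VuE x : x \in s -> (V - truncate (u n) s) x = v x - u n x.
    move=> xs; rewrite -sumrB ell2_sum.
    under eq_bigr => y _ do rewrite -scalerBl ell2Z deltaE.
    rewrite (bigD1_seq x)//= big1 ?addr0 => [|y /negbTE yx].
      by rewrite eqxx mulr1.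
    by rewrite eq_sym yx mulr0.
  rewrite (_ : \sum_(x <- s) _ =
      \sum_(x <- s) normc ((V - truncate (u n) s) x) ^+ 2).
    apply: le_trans (sum_le_l2norm _ us) _; exact: lerXn2r (l2norm_ge0 _) (e_ge0 n) Vn.
  by apply: eq_big_seq => x xs; rewrite VuE.
have [w0 w0E _] := vu 0%N; exists (w0 + u 0%N) => n; have [w wE wn] := vu n.
rewrite (_ : _ - u n = w)//; apply: ell2P => x.
by rewrite wE -[LHS]/(w0 x + u 0%N x - u n x) w0E subrK.
Qed.

End Completeness.

(** * Bounded maps and their adjoints *)

Section BoundedMaps.
Local Open Scope ring_scope.
Local Open Scope complex_scope.
Variable R : realType.

Definition norm_le (X Y : choiceType) (T : ell2 R X -> ell2 R Y) (e : R) : Prop :=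
  forall u, l2norm (T u) <= e * l2norm u.

Definition bounded_map (X Y : choiceType) (T : ell2 R X -> ell2 R Y) : Prop :=
  linear T /\ exists M, norm_le T M.

Definition adjoint_map (X Y : choiceType) (T : ell2 R X -> ell2 R Y)
    (T' : ell2 R Y -> ell2 R X) : Prop :=
  forall u v, inner (T u) v = inner u (T' v).

Section Linear.
Variables (X Y : choiceType) (T : ell2 R X -> ell2 R Y).
Hypothesis linT : linear T.
Implicit Types (u v : ell2 R X).

Lemma linear_D u v : T (u + v) = T u + T v.
Proof. by have := linT 1 u v; rewrite !scale1r. Qed.

Lemma linear_0 : T 0 = 0.
Proof. by apply: (addrI (T 0)); rewrite -linear_D !addr0. Qed.

Lemma linear_Z (c : R[i]) u : T (c *: u) = c *: T u.
Proof. by have := linT c u 0; rewrite linear_0 !addr0. Qed.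

Lemma linear_N u : T (- u) = - T u.
Proof. by rewrite -scaleN1r linear_Z scaleN1r. Qed.

Lemma linear_B u v : T (u - v) = T u - T v.
Proof. by rewrite linear_D linear_N. Qed.

Lemma linear_sum (I : Type) (s : seq I) (F : I -> ell2 R X) :
  T (\sum_(i <- s) F i) = \sum_(i <- s) T (F i).
Proof.
by elim: s => [|i s IHs]; rewrite ?big_nil ?linear_0// !big_cons linear_D IHs.
Qed.

End Linear.

(** The constant [2] comes from bounding the real and the imaginary part
    separately. *)
Lemma normc_inner_le (X : choiceType) (u v : ell2 R X) :
  normc (inner u v) <= 2 * (l2norm u * l2norm v).
Proof.
have Re_le (w : ell2 R X) : `|complex.Re (inner u w)| <= l2norm u * l2norm w.
  rewrite ler_norml cauchy_schwarz andbT.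
  by have := cauchy_schwarz u (- w); rewrite innerNr l2normN ReN lerNl.
apply: le_trans (normc_le_sum _) _.
have := Re_le ((- 'i) *: v); rewrite innerZr l2normZ.
have -> : normc (- 'i%C : R[i]) = 1.
  by rewrite /= oppr0 expr0n add0r sqrrN expr1n sqrtr1.
have -> : complex.Re (- 'i * inner u v) = complex.Im (inner u v).
  by case: (inner u v) => a b; rewrite /= oppr0 mul0r sub0r mulN1r opprK.
by have := Re_le v; rewrite mul1r; lra.
Qed.

Section Adjoint.
Variables X Y : choiceType.
Implicit Types (T U : ell2 R X -> ell2 R Y) (u v : ell2 R X).

Lemma bounded_map_ge0 T : bounded_map T -> exists2 M, 0 <= M & norm_le T M.
Proof.
move=> [_ [M TM]]; exists `|M| => // u; apply: le_trans (TM u) _.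
by apply: ler_wpM2r; rewrite ?l2norm_ge0// ler_norm.
Qed.

Lemma norm_le_weaken T (d e : R) : d <= e -> norm_le T d -> norm_le T e.
Proof.
by move=> de Td u; apply: le_trans (Td u) _; rewrite ler_wpM2r// l2norm_ge0.
Qed.

Lemma le0_of_all_eps (a M : R) : (forall e, 0 < e -> a <= M * e) -> a <= 0.
Proof.
move=> aM; apply/ler_addgt0Pr => e e0; rewrite add0r.
have M0 : 0 < `|M| + 1 by rewrite ltr_wpDl.
have := aM (e / (`|M| + 1)) (divr_gt0 e0 M0) => /le_trans; apply.
by rewrite mulrA ler_pdivrMr//; have := ler_norm M; nra.
Qed.

(** Finite truncations are dense and both maps are continuous. *)
Lemma eq_on_delta T U : bounded_map T -> bounded_map U ->
  (forall x, T (delta R x) = U (delta R x)) -> T = U.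
Proof.
move=> bT bU TU; apply/funext => u; apply/eqP; rewrite -subr_eq0; apply/eqP.
have [M M0 TM] := bounded_map_ge0 bT; have [N N0 UN] := bounded_map_ge0 bU.
have [[linT _] [linU _]] := (bT, bU).
apply/l2norm_eq0/eqP; rewrite eq_le l2norm_ge0 andbT.
apply: (@le0_of_all_eps _ (M + N)) => e e0.
have [s us ue] := truncate_dense u e0.
have TUs : T (truncate u s) = U (truncate u s).
  rewrite (linear_sum linT) (linear_sum linU); apply: eq_bigr => x _.
  by rewrite (linear_Z linT) (linear_Z linU) TU.
have -> : T u - U u = T (u - truncate u s) - U (u - truncate u s).
  by rewrite (linear_B linT) (linear_B linU) TUs opprB addrA subrK.
apply: le_trans (ler_l2normD _ _) _; rewrite l2normN mulrDl; apply: lerD.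
  by apply: le_trans (TM _) _; rewrite ler_wpM2l.
by apply: le_trans (UN _) _; rewrite ler_wpM2l.
Qed.

(** Both sides of the adjunction are continuous in the first vector, so it is
    enough to compare them on the canonical basis. *)
Lemma adjoint_of_delta T (T' : ell2 R Y -> ell2 R X) : bounded_map T ->
  (forall x (v : ell2 R Y), T' v x = inner (T (delta R x)) v) -> adjoint_map T T'.
Proof.
move=> bT T'E u v; apply/eqP; rewrite -subr_eq0; apply/eqP/eq0_normc.
have [M M0 TM] := bounded_map_ge0 bT; have [linT _] := bT.
apply/eqP; rewrite eq_le normc_ge0 andbT.
apply: (@le0_of_all_eps _ (2 * (M * l2norm v) + 2 * l2norm (T' v))) => e e0.
have [s us ue] := truncate_dense u e0.
have Ts : inner (T (truncate u s)) v = inner (truncate u s) (T' v).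
  rewrite (linear_sum linT) !inner_suml; apply: eq_bigr => x _.
  by rewrite (linear_Z linT) !innerZl inner_delta T'E.
have -> : inner (T u) v - inner u (T' v) =
    inner (T (u - truncate u s)) v - inner (u - truncate u s) (T' v).
  by rewrite (linear_B linT) !innerBl Ts opprB addrA subrK.
apply: le_trans (le_normcD _ _) _; rewrite normcN mulrDl; apply: lerD.
  apply: le_trans (normc_inner_le _ _) _; rewrite -!mulrA ler_wpM2l//.
  rewrite (mulrC (l2norm v)) mulrA ler_wpM2r ?l2norm_ge0//.
  by apply: le_trans (TM _) _; rewrite ler_wpM2l.
apply: le_trans (normc_inner_le _ _) _; rewrite -!mulrA ler_wpM2l//.
by rewrite mulrC ler_wpM2l ?l2norm_ge0.
Qed.

End Adjoint.

Section AdjointTheory.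
Variables X Y : choiceType.
Implicit Types (T U : ell2 R X -> ell2 R Y).

Lemma adjoint_map_sym T (T' : ell2 R Y -> ell2 R X) :
  adjoint_map T T' -> adjoint_map T' T.
Proof. by move=> TT' u v; rewrite innerC -TT' -innerC. Qed.

Lemma adjoint_map_linear T (T' : ell2 R Y -> ell2 R X) :
  adjoint_map T T' -> linear T'.
Proof.
move=> TT' c u v; apply/eqP; rewrite -subr_eq0; apply/eqP/inner_eq0 => w.
rewrite innerC innerBr innerDr innerZr -!TT' innerDr innerZr subrr.
exact: conjC0.
Qed.

Lemma adjoint_map_norm T (T' : ell2 R Y -> ell2 R X) (e : R) :
  0 <= e -> adjoint_map T T' -> norm_le T e -> norm_le T' e.
Proof.
move=> e0 TT' Te v.
have [->|v0] := eqVneq (l2norm (T' v)) 0; first by rewrite mulr_ge0 ?l2norm_ge0.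
have n0 : 0 < l2norm (T' v) by rewrite lt_def v0 l2norm_ge0.
rewrite -(ler_pM2l n0) -expr2.
have := inner_self (T' v); rewrite -TT' => /(congr1 (@complex.Re R)) /= <-.
apply: le_trans (cauchy_schwarz _ _) _.
by rewrite mulrA [_ * e]mulrC ler_wpM2r ?l2norm_ge0.
Qed.

Lemma adjoint_map_unique T (T1 T2 : ell2 R Y -> ell2 R X) :
  adjoint_map T T1 -> adjoint_map T T2 -> T1 = T2.
Proof.
move=> h1 h2; apply/funext => v; apply/eqP; rewrite -subr_eq0; apply/eqP.
by apply: inner_eq0 => w; rewrite innerC innerBr -h1 -h2 subrr conjC0.
Qed.

(** The coordinates of the image of [v] under the adjoint must be the inner
    products of [T (delta x)] with [v].  This family is square summable because
    [T] is bounded on the finite truncations of the family itself. *)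
Lemma exists_adjoint T : bounded_map T ->
  exists2 T', bounded_map T' & adjoint_map T T'.
Proof.
move=> bT; have [M M0 TM] := bounded_map_ge0 bT; have [linT _] := bT.
pose g v x := inner (T (delta R x)) v.
have gv v : {w : ell2 R X | ell2_fun w = g v & l2norm w <= M * l2norm v}.
  apply: ell2_bound => [|s us]; first by rewrite mulr_ge0 ?l2norm_ge0.
  set S2 := \sum_(x <- s) _.
  pose w : ell2 R X := \sum_(x <- s) g v x *: delta R x.
  have S2E : complex.Re (inner (T w) v) = S2.
    rewrite (linear_sum linT) inner_suml.
    rewrite (raddf_sum (@complex.Re R : {additive R[i] -> R})).
    apply: eq_bigr => x _; rewrite (linear_Z linT) innerZl -/(g v x) normc_sqr.
    by case: (g v x) => a b /=; rewrite mulNr opprK !expr2.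
  have wE x : x \in s -> w x = g v x.
    move=> xs; rewrite ell2_sum; under eq_bigr do rewrite ell2Z deltaE.
    rewrite (bigD1_seq x)//= big1 ?addr0 => [|y /negbTE yx].
      by rewrite eqxx mulr1.
    by rewrite eq_sym yx mulr0.
  have wS : l2norm w ^+ 2 = S2.
    have := inner_self w; rewrite {1}/w inner_suml.
    move=> /(congr1 (@complex.Re R)) /= <-.
    rewrite (raddf_sum (@complex.Re R : {additive R[i] -> R})).
    apply: eq_big_seq => x xs; rewrite innerZl inner_delta wE// normc_sqr.
    by case: (g v x) => a b /=; rewrite mulNr opprK !expr2.
  have := cauchy_schwarz (T w) v; rewrite S2E -wS => Sle.
  have {}Sle : l2norm w ^+ 2 <= M * l2norm v * l2norm w.
    apply: le_trans Sle _; rewrite mulrAC.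
    by rewrite ler_wpM2r ?l2norm_ge0.
  have [->|w0] := eqVneq (l2norm w) 0; first by rewrite expr0n sqr_ge0.
  rewrite lerXn2r ?nnegrE ?mulr_ge0 ?l2norm_ge0//.
  have n0 : 0 < l2norm w by rewrite lt_def w0 l2norm_ge0.
  by rewrite -(ler_pM2r n0) -expr2.
pose T' v := s2val (gv v).
have TT' : adjoint_map T T'.
  by apply: adjoint_of_delta => // x v; rewrite /T' (s2valP (gv v)).
exists T' => //; split; first exact: adjoint_map_linear TT'.
by exists M; exact: adjoint_map_norm TT' TM.
Qed.

(** Matrix multiplication: the coordinate [y] of [T u] only involves the
    coordinates [z] of [u] for which the matrix entry [(y, z)] of [T] does not
    vanish. *)
Lemma coord_neq0 T u y : bounded_map T -> T u y != 0 ->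
  exists z, u z != 0 /\ T (delta R z) y != 0.
Proof.
move=> bT; have [T' bT' TT'] := exists_adjoint bT.
rewrite -inner_delta -(adjoint_map_sym TT').
apply: contraNP => h; apply/eqP; rewrite -[RHS](inner0r (T' (delta R y))).
congr csum; apply/funext => z; rewrite ell20 mulr0.
have [->|uz] := eqVneq (u z) 0; first by rewrite mulr0.
rewrite -(inner_delta z (T' _)) -TT' innerC inner_delta.
have [->|Tz] := eqVneq (T (delta R z) y) 0; first by rewrite !conjC0 mul0r.
by case: h; exists z.
Qed.

End AdjointTheory.
End BoundedMaps.

(** * C*-algebras of operators *)

Section OperatorAlgebra.
Local Open Scope ring_scope.
Local Open Scope complex_scope.
Variables (R : realType) (X : choiceType).
Implicit Types (T U : op R X) (A G : set (op R X)) (d e : R).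

Lemma norm_leD T U d e : norm_le T d -> norm_le U e -> norm_le (T + U) (d + e).
Proof.
move=> Td Ue u; rewrite mulrDl; apply: le_trans (ler_l2normD _ _) _.
by apply: lerD; [exact: Td|exact: Ue].
Qed.

Lemma norm_leZ (c : R[i]) T d : norm_le T d -> norm_le (c *: T) (normc c * d).
Proof.
move=> Td u; rewrite -[(c *: T) u]/(c *: T u) l2normZ -mulrA.
by rewrite ler_wpM2l ?normc_ge0.
Qed.

Lemma norm_leN T d : norm_le T d -> norm_le (- T) d.
Proof. by move=> Td u; rewrite -[(- T) u]/(- T u) l2normN. Qed.

Lemma norm_leB T U d e : norm_le T d -> norm_le U e -> norm_le (T - U) (d + e).
Proof. by move=> Td Ue; apply: norm_leD => //; exact: norm_leN. Qed.

Lemma norm_le_comp T U d e : 0 <= d -> norm_le T d -> norm_le U e ->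
  norm_le (T \o U) (d * e).
Proof.
move=> d0 Td Ue u; apply: (le_trans (Td _)); rewrite -mulrA.
exact: ler_wpM2l (Ue u).
Qed.

Lemma linear_op_add T U : linear T -> linear U -> linear (T + U).
Proof.
move=> lT lU c u v; rewrite -[LHS]/(T _ + U _) lT lU.
rewrite -[(T + U) u]/(T u + U u) -[(T + U) v]/(T v + U v) scalerDr.
by rewrite addrACA.
Qed.

Lemma linear_op_comp T U : linear T -> linear U -> linear (T \o U).
Proof. by move=> lT lU c u v; rewrite /= lU lT. Qed.

Lemma linear_op_scale (c : R[i]) T : linear T -> linear (c *: T).
Proof.
move=> lT d u v; rewrite -[LHS]/(c *: T _) lT scalerDr !scalerA mulrC.
by rewrite -scalerA.
Qed.

(** Provides the closure properties of bounded operators; being an adjoint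
    includes being bounded. *)
Lemma bounded_op_cstar : cstar_subalgebra (@bounded_op R X).
Proof.
split=> //.
- split; last by exists 0 => u; rewrite mul0r -[(0 : op R X) u]/(0) l2norm0.
  by move=> c u v; rewrite -[LHS]/(0) -[RHS]/(c *: 0 + 0) scaler0 addr0.
- move=> T U bT bU; have [M M0 TM] := bounded_map_ge0 bT.
  have [[lT _] [lU [N UN]]] := (bT, bU); split; split.
  + exact: linear_op_add.
  + by exists (M + N); exact: norm_leD.
  + exact: linear_op_comp.
  + by exists (M * N); exact: norm_le_comp.
- move=> c T [lT [M TM]]; split; first exact: linear_op_scale.
  by exists (normc c * M); exact: norm_leZ.
- by split=> // T T' _ [].
Qed.

Lemma cstar_generated_cstar G : G `<=` @bounded_op R X ->
  cstar_subalgebra (cstar_generated G).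
Proof.
move=> Gb; split.
- by move=> T; apply; split=> //; exact: bounded_op_cstar.
- by move=> A [[]].
- move=> T U GT GU; split=> A AG; have [[_ _ AD _ _] _] := AG;
    by have [] := AD T U (GT A AG) (GU A AG).
- by move=> c T GT A AG; have [[_ _ _ AZ _] _] := AG; exact: AZ (GT A AG).
- split=> [T T' GT TT' A AG|T bT TU A AG].
    by have [[_ _ _ _ [Aadj _]] _] := AG; exact: Aadj (GT A AG) TT'.
  have [[_ _ _ _ [_ Acl]] _] := AG; apply: Acl => // e e0.
  by have [U GU Ue] := TU e e0; exists U => //; exact: GU.
Qed.

Lemma sub_cstar_generated G : G `<=` cstar_generated G.
Proof. by move=> T GT A [_]; exact. Qed.

Lemma cstar_generated_sub G A : cstar_subalgebra A -> G `<=` A ->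
  cstar_generated G `<=` A.
Proof. by move=> cA GA T; apply. Qed.

Section CstarClosure.
Variable A : set (op R X).
Hypothesis cA : cstar_subalgebra A.

Lemma cstar_bounded T : A T -> bounded_op T.
Proof. by have [Ab _ _ _ _] := cA; exact: Ab. Qed.

Lemma cstar0 : A 0. Proof. by have [] := cA. Qed.

Lemma cstarD T U : A T -> A U -> A (T + U).
Proof. by have [_ _ AD _ _] := cA => AT AU; have [] := AD T U AT AU. Qed.

Lemma cstarM T U : A T -> A U -> A (T \o U).
Proof. by have [_ _ AD _ _] := cA => AT AU; have [] := AD T U AT AU. Qed.

Lemma cstarZ (c : R[i]) T : A T -> A (c *: T).
Proof. by have [_ _ _ AZ _] := cA; exact: AZ. Qed.

Lemma cstarB T U : A T -> A U -> A (T - U).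
Proof. by move=> AT AU; rewrite -scaleN1r; apply: cstarD => //; exact: cstarZ. Qed.

Lemma cstar_sum (I : eqType) (s : seq I) (F : I -> op R X) :
  (forall i, i \in s -> A (F i)) -> A (\sum_(i <- s) F i).
Proof.
move=> AF; rewrite big_seq; elim/big_ind: _ => //; first exact: cstar0.
exact: cstarD.
Qed.

Lemma cstar_adjoint T : A T -> exists2 T', A T' & adjoint T T'.
Proof.
move=> AT; have [T' bT' TT'] := exists_adjoint (cstar_bounded AT).
have aT : adjoint T T' by split.
by exists T' => //; have [_ _ _ _ [Aadj _]] := cA; exact: Aadj aT.
Qed.

End CstarClosure.

(** The limit exists pointwise, and the uniform rate of convergence makes it
    linear and bounded. *)
Lemma op_complete (F : nat -> op R X) (e : nat -> R) :
  (forall n, bounded_op (F n)) -> (forall n, 0 <= e n) ->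
  (forall n m, (n <= m)%N -> norm_le (F m - F n) (e n)) ->
  (forall r, 0 < r -> exists n0, forall n, (n0 <= n)%N -> e n <= r) ->
  exists2 T, bounded_op T & forall n, norm_le (T - F n) (e n).
Proof.
move=> bF e0 Fe elim0.
have lim u : exists v, forall n, l2norm (v - F n u) <= e n * l2norm u.
  apply: (@l2_complete _ _ (fun n => F n u) (fun n => e n * l2norm u)).
    by move=> n m nm; exact: Fe.
  move=> r r0; have u0 := l2norm_ge0 u.
  have u1 : 0 < l2norm u + 1 by rewrite ltr_wpDl.
  have [n0 n0P] := elim0 (r / (l2norm u + 1)) (divr_gt0 r0 u1).
  exists n0 => n /n0P; rewrite ler_pdivlMr// => h; apply: le_trans h.
  by rewrite ler_wpM2l// lerDl.
have [T TP] := choice lim.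
have bT n : norm_le (T - F n) (e n) by move=> u; exact: TP.
exists T => //; split.
  move=> c u v; apply/eqP; rewrite -subr_eq0; apply/eqP/l2norm_eq0/eqP.
  rewrite eq_le l2norm_ge0 andbT.
  apply: (@le0_of_all_eps _ _
    (l2norm (c *: u + v) + normc c * l2norm u + l2norm v)) => r r0.
  have [n /(_ _ (leqnn n)) en] := elim0 r r0.
  have [lF _] := bF n.
  have -> : T (c *: u + v) - (c *: T u + T v) =
      (T (c *: u + v) - F n (c *: u + v)) - c *: (T u - F n u) - (T v - F n v).
    rewrite lF scalerBr !opprB !opprD !addrA.
    by rewrite [RHS](ACl (1*5*7*2*4*3*6))/= !addrNK.
  apply: le_trans (ler_l2normD _ _) _; rewrite l2normN mulrDl; apply: lerD; last first.
    by apply: (le_trans (TP v n)); rewrite mulrC ler_wpM2l ?l2norm_ge0.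
  apply: le_trans (ler_l2normD _ _) _; rewrite l2normN mulrDl; apply: lerD.
    by apply: (le_trans (TP _ n)); rewrite mulrC ler_wpM2l ?l2norm_ge0.
  rewrite l2normZ -mulrA ler_wpM2l ?normc_ge0//.
  by apply: (le_trans (TP _ n)); rewrite mulrC ler_wpM2l ?l2norm_ge0.
have [M M0 FM] := bounded_map_ge0 (bF 0%N).
exists (e 0%N + M); rewrite -[T](subrK (F 0%N)).
exact: norm_leD.
Qed.

Lemma geometric_small (r c : R) : 0 <= r < 1 -> 0 < c ->
  exists n0, forall n, (n0 <= n)%N -> r ^+ n <= c.
Proof.
move=> /andP[r0 r1] c0.
have : (fun n => r ^+ n) @ \oo --> (0 : R) by apply: cvg_expr; rewrite ger0_norm.
move=> /cvgrPdist_le /(_ c c0) [n0 _ n0P]; exists n0 => n /n0P.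
by rewrite sub0r normrN ger0_norm// exprn_ge0.
Qed.

End OperatorAlgebra.

(** * Images and preimages under contractive homomorphisms *)

Section ResolventApproximation.
Local Open Scope ring_scope.
Local Open Scope complex_scope.
Variables (R : realType) (X : choiceType).
Implicit Types (a b : op R X) (u v : ell2 R X) (m e : R).

(** Partial sums of the Neumann series of [a \o (1 + b \o a)^-1], written
    without the identity operator. *)
Fixpoint resolvent_approx a b m (n : nat) : op R X :=
  if n is k.+1 then
    (1 + m)^-1%:C *: (a + m%:C *: resolvent_approx a b m k
                        - (resolvent_approx a b m k \o (b \o a)))
  else 0.

Lemma resolvent_approx_in (A : set (op R X)) a b m n :
  cstar_subalgebra A -> A a -> A b -> A (resolvent_approx a b m n).
Proof.
move=> cA Aa Ab; elim: n => [|n IHn] /=; first exact: (cstar0 cA).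
apply: (cstarZ cA) => //; apply: (cstarB cA) => //.
  by apply: (cstarD cA) => //; exact: (cstarZ cA).
by apply: (cstarM cA) => //; exact: (cstarM cA).
Qed.

(** As [b] is the adjoint of [a] and has norm at most [e], one has
    [0 <= b \o a <= e ^+ 2 <= 2 * m] as operators, so that [m - b \o a] has norm
    at most [m]. *)
Lemma shift_contraction a b m e u : bounded_op a -> adjoint_map a b ->
  0 <= m -> 0 <= e -> norm_le b e -> e ^+ 2 <= 2 * m ->
  l2norm (m%:C *: u - b (a u)) <= m * l2norm u.
Proof.
move=> ba ab m0 e0 be em.
rewrite -(@ler_pXn2r _ 2)// ?nnegrE ?mulr_ge0 ?l2norm_ge0// l2norm_sqrD l2normN.
rewrite innerNr innerZl conj_real -ab inner_self ReN Re_realM/= l2normZ normc_real//.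
have bau : l2norm (b (a u)) ^+ 2 <= 2 * m * l2norm (a u) ^+ 2.
  apply: (@le_trans _ _ (e ^+ 2 * l2norm (a u) ^+ 2)).
    by rewrite -exprMn lerXn2r ?nnegrE ?mulr_ge0 ?l2norm_ge0.
  by rewrite ler_wpM2r// sqr_ge0.
by lra.
Qed.

(** The approximations factor through [a], via a vector [v] which nearly solves
    [v + b (a v) = u]. *)
Lemma resolvent_approx_factor a b m e n u : bounded_op a -> bounded_op b ->
  adjoint_map a b -> 0 <= m -> 0 <= e -> norm_le b e -> e ^+ 2 <= 2 * m ->
  exists v, resolvent_approx a b m n u = a v /\
    l2norm (v + b (a v) - u) <= (m / (1 + m)) ^+ n * l2norm u.
Proof.
move=> ba bb ab m0 e0 be em; have [[la _] [lb _]] := (ba, bb).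
have lr k : linear (resolvent_approx a b m k).
  by have [] := resolvent_approx_in m k (bounded_op_cstar R X) ba bb.
have m1 : 0 < 1 + m by rewrite ltr_wpDr.
have m1C : (1 + m)^-1%:C * m%:C + (1 + m)^-1%:C = 1 :> R[i].
  have mn0 : m + 1 != 0 by rewrite addrC gt_eqF.
  rewrite [1 + m]addrC -[X in _ + X]mulr1 -mulrDr -rmorphD/= -rmorphM/=.
  by rewrite (mulVf mn0).
elim: n u => [|n IHn] u.
  exists 0; rewrite (linear_0 la) (linear_0 lb) addr0 sub0r l2normN mul1r.
  by split.
set z := (1 + m)^-1%:C *: (m%:C *: u - b (a u)).
have [v [vE vu]] := IHn z.
exists ((1 + m)^-1%:C *: u + v); split.
  rewrite (linear_D la) -vE (linear_Z la) /z (linear_Z (lr n)).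
  rewrite (linear_B (lr n)) (linear_Z (lr n)) -scalerDr.
  by rewrite -[LHS]/(_ *: (a u + _ *: _ - _)) addrA.
rewrite (linear_D la) (linear_D lb) (linear_Z la) (linear_Z lb).
have -> : (1 + m)^-1%:C *: u + v + ((1 + m)^-1%:C *: b (a u) + b (a v)) - u
    = v + b (a v) - z.
  rewrite /z -[X in _ - X = _](scale1r u) -m1C scalerDl scalerBr !scalerA.
  rewrite !opprD !opprK !addrA [LHS](ACl (2*4*5*3*1*6))/= addrK.
  by rewrite -!addrA.
apply: le_trans vu _; rewrite exprSr -mulrA ler_wpM2l ?exprn_ge0 ?divr_ge0 ?(ltW m1)//.
rewrite /z l2normZ normc_real ?invr_ge0 ?(ltW m1)// mulrAC [leRHS]mulrC ler_wpM2l//.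
  by rewrite invr_ge0 ltW.
exact: (shift_contraction u ba ab m0 e0 be em).
Qed.

(** This is [t / (1 + t ^+ 2) <= 1 / 2] for the modulus [t] of [a]. *)
Lemma resolvent_half a b v : adjoint_map a b ->
  2 * l2norm (a v) <= l2norm (v + b (a v)).
Proof.
move=> ab.
rewrite -(@ler_pXn2r _ 2)// ?nnegrE ?mulr_ge0 ?l2norm_ge0// l2norm_sqrD.
rewrite -ab inner_self/=.
have : l2norm (a v) ^+ 2 <= l2norm v * l2norm (b (a v)).
  have := cauchy_schwarz v (b (a v)).
  by rewrite -ab inner_self.
have := sqr_ge0 (l2norm v - l2norm (b (a v))); nra.
Qed.

End ResolventApproximation.

Section Image.
Local Open Scope ring_scope.
Local Open Scope complex_scope.
Variables (R : realType) (X Y : choiceType).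
Variables (A : set (op R X)) (Phi : op R X -> op R Y).
Hypotheses (cA : cstar_subalgebra A) (homPhi : star_hom A Phi).
Hypothesis contr : forall T e, 0 <= e -> A T -> norm_le T e -> norm_le (Phi T) e.
Implicit Types (T U : op R X) (m e r : R).

Let Phi_bounded T : A T -> bounded_op (Phi T).
Proof. by have [h _ _ _ _] := homPhi; exact: h. Qed.

Let PhiD T U : A T -> A U -> Phi (T + U) = Phi T + Phi U.
Proof. by have [_ h _ _ _] := homPhi; exact: h. Qed.

Let PhiZ (c : R[i]) T : A T -> Phi (c *: T) = c *: Phi T.
Proof. by have [_ _ h _ _] := homPhi; exact: h. Qed.

Let PhiM T U : A T -> A U -> Phi (T \o U) = Phi T \o Phi U.
Proof. by have [_ _ _ h _] := homPhi; exact: h. Qed.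

Let Phi_adjoint T T' : A T -> adjoint T T' -> adjoint (Phi T) (Phi T').
Proof. by have [_ _ _ _ h] := homPhi; exact: h. Qed.

Let PhiB T U : A T -> A U -> Phi (T - U) = Phi T - Phi U.
Proof.
move=> AT AU; have ANU : A (- 1 *: U) by exact: (cstarZ cA).
by rewrite -scaleN1r (PhiD AT ANU) PhiZ// scaleN1r.
Qed.

Let Phi0 : Phi 0 = 0.
Proof. by rewrite -(scale0r (0 : op R X)) PhiZ ?scale0r//; exact: (cstar0 cA). Qed.

Let Phi_resolvent T U m n : A T -> A U ->
  Phi (resolvent_approx T U m n) = resolvent_approx (Phi T) (Phi U) m n.
Proof.
move=> AT AU; elim: n => [|n IHn]; first exact: Phi0.
have Ar := resolvent_approx_in m n cA AT AU.
have AUT : A (U \o T) by exact: (cstarM cA).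
have ArUT : A (resolvent_approx T U m n \o (U \o T)) by exact: (cstarM cA).
have Amr : A (m%:C *: resolvent_approx T U m n) by exact: (cstarZ cA m%:C Ar).
have ATmr : A (T + m%:C *: resolvent_approx T U m n) by exact: (cstarD cA).
rewrite [LHS]PhiZ; last exact: (cstarB cA).
by rewrite PhiB// PhiD// PhiZ// (PhiM Ar AUT) (PhiM AU AT) IHn.
Qed.

(** The key to the closedness of the image: if [Phi T] is a contraction, then
    [T \o (1 + T^* \o T)^-1] has norm at most [1 / 2], whatever the norm of [T],
    while its image differs from [Phi T] by at most [1 / 2].  The constants below
    leave room for the error in the approximation of the resolvent. *)
Lemma lift_unit T : A T -> norm_le (Phi T) 1 ->
  exists2 U, A U & norm_le U 1 /\ norm_le (Phi T - Phi U) (7 / 8).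
Proof.
move=> AT PT1; have [T' AT' aT] := cstar_adjoint cA AT.
have [bT' TT'] := aT; have [_ PTT'] := Phi_adjoint AT aT.
have [M M0 T'M] := bounded_map_ge0 bT'.
(* The same shift [m] serves for [T] and for [Phi T], so that [Phi] maps one
   approximation of the resolvent to the other. *)
have [m [m0 Mm]] : exists m, 0 <= m /\ M ^+ 2 <= 2 * m.
  by exists (M ^+ 2); split; [exact: sqr_ge0|have := sqr_ge0 M; lra].
have m1 : 0 < 1 + m by rewrite ltr_wpDr.
have rlt1 : 0 <= m / (1 + m) < 1.
  by rewrite divr_ge0 ?(ltW m1)//= ltr_pdivrMr// mul1r ltrDr.
have [n /(_ _ (leqnn n)) rn] := geometric_small rlt1 (divr_gt0 ltr01 (ltr0n R 4)).
have PT'1 := adjoint_map_norm ler01 PTT' PT1.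
exists (resolvent_approx T T' m n); first exact: resolvent_approx_in.
split=> u.
  have [v [-> vu]] := resolvent_approx_factor n u (cstar_bounded cA AT) bT' TT'
    m0 M0 T'M Mm.
  have := resolvent_half v TT'.
  have := ler_l2normD (v + T' (T v) - u) u; rewrite subrK.
  have := ler_wpM2r (l2norm_ge0 u) rn; move: vu.
  by have := l2norm_ge0 u; rewrite mul1r; set x := _ * l2norm u; lra.
rewrite Phi_resolvent//.
have [v [vE vu]] := resolvent_approx_factor n u (Phi_bounded AT) (Phi_bounded AT')
  PTT' m0 M0 (contr M0 AT' T'M) Mm.
rewrite -[_ u]/(Phi T u - resolvent_approx _ _ _ _ u) vE.
have [lPT _] := Phi_bounded AT; rewrite -(linear_B lPT).
apply: le_trans (PT1 _) _; rewrite mul1r.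
have -> : u - v = Phi T' (Phi T v) - (v + Phi T' (Phi T v) - u).
  by rewrite opprB opprD !addrA [RHS](ACl (2*3*(1*4)))/= subrr addr0.
apply: le_trans (ler_l2normD _ _) _; rewrite l2normN.
have := PT'1 (Phi T v); rewrite mul1r.
have := resolvent_half v PTT'.
have := ler_l2normD (v + Phi T' (Phi T v) - u) u; rewrite subrK.
have := ler_wpM2r (l2norm_ge0 u) rn; move: vu.
by have := l2norm_ge0 u; set x := _ ^+ n * l2norm u; lra.
Qed.

Lemma lift_scaled T r : 0 < r -> A T -> norm_le (Phi T) r ->
  exists2 U, A U & norm_le U r /\ norm_le (Phi T - Phi U) (7 / 8 * r).
Proof.
move=> r0 AT PTr; have rC : r%:C != 0 :> R[i].
  by apply/eqP => -[] r00; rewrite r00 ltxx in r0.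
have [||U AU [U1 PU]] := @lift_unit (r^-1%:C *: T).
- exact: (cstarZ cA).
- rewrite PhiZ// => u; have := norm_leZ r^-1%:C PTr u.
  by rewrite normc_real ?invr_ge0 ?(ltW r0)// (mulVf (lt0r_neq0 r0)).
exists (r%:C *: U); first exact: (cstarZ cA).
split=> [u|].
  by have := norm_leZ r%:C U1 u; rewrite (normc_real (ltW r0)) mulr1.
have -> : Phi T - Phi (r%:C *: U) = r%:C *: (Phi (r^-1%:C *: T) - Phi U).
  rewrite scalerBr (PhiZ _ AT) (PhiZ _ AU) scalerA -rmorphM/=.
  by rewrite (divff (lt0r_neq0 r0)) scale1r.
move=> u; have := norm_leZ r%:C PU u.
by rewrite (normc_real (ltW r0)) [r * _]mulrC.
Qed.

(** The ratio [15 / 16] absorbs the distance [r / 32] from [V] to an element of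
    the image, on top of the factor [7 / 8]. *)
Lemma lift_step (V : op R Y) T r : 0 < r -> A T ->
  (forall e, 0 < e -> exists2 W, (Phi @` A) W & norm_le (V - W) e) ->
  norm_le (V - Phi T) r ->
  exists2 U, A U & norm_le (U - T) (2 * r) /\ norm_le (V - Phi U) (15 / 16 * r).
Proof.
move=> r0 AT Vlim VT.
have r32 : 0 < r / 32 by rewrite divr_gt0.
have [_ [T0 AT0 <-] VT0] := Vlim _ r32.
have AT1 : A (T0 - T) by exact: (cstarB cA).
have r1 : 0 < r + r / 32 by rewrite addr_gt0.
have [|U AU [Ur PU]] := lift_scaled r1 AT1.
  rewrite PhiB// (_ : _ - _ = (V - Phi T) - (V - Phi T0)).
    exact: norm_leB.
  by rewrite opprB addrA [RHS](ACl (3*2*(1*4)))/= subrr addr0.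
exists (T + U); first exact: (cstarD cA).
rewrite addrAC subrr add0r; split.
  by apply: norm_le_weaken Ur; lra.
rewrite PhiD//.
have -> : V - (Phi T + Phi U) = (V - Phi T0) + (Phi (T0 - T) - Phi U).
  by rewrite PhiB// opprD !addrA addrNK.
by apply: norm_le_weaken (norm_leD VT0 PU); lra.
Qed.

(** Successive approximation: the error decreases by the factor [15 / 16] at each
    step, and the lifts of the corrections decrease at the same rate. *)
Lemma image_norm_closed : norm_closed (Phi @` A).
Proof.
move=> V bV Vlim.
have [M M0 VM] := bounded_map_ge0 bV.
pose q : R := 15 / 16; have q0 : 0 <= q by rewrite /q; lra.
have q1 : q < 1 by rewrite /q; lra.
have qn0 n : 0 < q ^+ n by rewrite exprn_gt0// /q; lra.
pose r n := (M + 1) * q ^+ n.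
have r0 n : 0 < r n by rewrite mulr_gt0// ltr_wpDl.
have step (p : op R X * nat) : exists U, A p.1 -> norm_le (V - Phi p.1) (r p.2) ->
    [/\ A U, norm_le (U - p.1) (2 * r p.2) & norm_le (V - Phi U) (r p.2.+1)].
  have [AT|] := pselect (A p.1); last by exists 0.
  have [VT|] := pselect (norm_le (V - Phi p.1) (r p.2)); last by exists 0.
  have [U AU [Ur VU]] := lift_step (r0 _) AT Vlim VT.
  by exists U => _ _; split=> //; rewrite /r exprS mulrCA.
have [f fP] := choice step.
pose F := fix F n := if n is k.+1 then f (F k, k) else (0 : op R X).
have FP n : A (F n) /\ norm_le (V - Phi (F n)) (r n).
  elim: n => [|n [AF VF]]; last by have [] := fP (F n, n) AF VF.
  rewrite /= Phi0 subr0 /r expr0 mulr1; split; first exact: (cstar0 cA).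
  by apply: norm_le_weaken VM; rewrite lerDl.
have Fstep n : norm_le (F n.+1 - F n) (2 * r n).
  by have [AF VF] := FP n; have [] := fP (F n, n) AF VF.
have Fdist n k : norm_le (F (n + k)%N - F n) (32 * (r n - r (n + k)%N)).
  elim: k => [|k IHk].
    by rewrite addn0 !subrr mulr0 => u; rewrite mul0r l2norm0.
  rewrite addnS -(subrK (F (n + k)%N) (F (n + k).+1)) -addrA.
  apply: norm_le_weaken (norm_leD (Fstep _) IHk).
  by rewrite /r exprS /q; lra.
have [||||T bT TF] := @op_complete _ _ F (fun n => 32 * r n).
- by move=> n; apply: (cstar_bounded cA); have [] := FP n.
- by move=> n; rewrite mulr_ge0// ltW.
- move=> n m nm; rewrite -(subnKC nm); apply: norm_le_weaken (Fdist _ _).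
  by have := r0 (n + (m - n))%N; lra.
- move=> e e0.
  have [||n0 n0P] := @geometric_small _ q (e / (32 * (M + 1))).
  + by rewrite q0.
  + by rewrite divr_gt0// mulr_gt0// ltr_wpDl.
  exists n0 => n /n0P; rewrite ler_pdivlMr ?mulr_gt0// ?ltr_wpDl//.
  by rewrite /r mulrC mulrA.
have rsmall e : 0 < e -> exists n, r n <= e.
  move=> e0; have [||n0 n0P] := @geometric_small _ q (e / (M + 1)).
  + by rewrite q0.
  + by rewrite divr_gt0// ltr_wpDl.
  exists n0; have := n0P n0 (leqnn _); rewrite ler_pdivlMr ?ltr_wpDl//.
  by rewrite mulrC.
have AT : A T.
  have [_ _ _ _ [_ Acl]] := cA; apply: Acl => // e e0.
  have [|n rn] := rsmall (e / 32); first by rewrite divr_gt0.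
  exists (F n); first by have [] := FP n.
  apply: norm_le_weaken (TF n); lra.
exists T => //; apply/funext => u; apply/eqP; rewrite eq_sym -subr_eq0; apply/eqP.
apply/l2norm_eq0/eqP; rewrite eq_le l2norm_ge0 andbT.
apply: (@le0_of_all_eps _ _ (33 * l2norm u)) => e e0.
have [n rn] := rsmall e e0; have [AF VF] := FP n.
have PTF : norm_le (Phi T - Phi (F n)) (32 * r n).
  rewrite -PhiB//; apply: contr (TF n); last exact: (cstarB cA).
  by rewrite mulr_ge0// ltW.
have -> : V u - Phi T u = (V - Phi T) u by [].
rewrite (_ : V - Phi T = (V - Phi (F n)) - (Phi T - Phi (F n))); last first.
  by rewrite opprB addrA addrNK.
apply: le_trans (norm_leB VF PTF u) _.
rewrite [leRHS]mulrAC ler_wpM2r ?l2norm_ge0//; lra.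
Qed.

Lemma image_cstar : cstar_subalgebra (Phi @` A).
Proof.
split.
- by move=> _ [T AT <-]; exact: Phi_bounded.
- by exists 0; [exact: (cstar0 cA)|exact: Phi0].
- move=> _ _ [T AT <-] [U AU <-]; split.
    by exists (T + U); [exact: (cstarD cA)|exact: PhiD].
  by exists (T \o U); [exact: (cstarM cA)|exact: PhiM].
- by move=> c _ [T AT <-]; exists (c *: T); [exact: (cstarZ cA)|exact: PhiZ].
split; last exact: image_norm_closed.
move=> _ V' [T AT <-] [_ TV'].
have [T' AT' aT] := cstar_adjoint cA AT; exists T' => //.
have [_ PTT'] := Phi_adjoint AT aT.
exact: adjoint_map_unique PTT' TV'.
Qed.

(** Used to bound an image from above: to map a generated C*-algebra into [B] it
    is enough to map its generators into [B]. *)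
Lemma preimage_cstar (B : set (op R Y)) : cstar_subalgebra B ->
  cstar_subalgebra (A `&` Phi @^-1` B).
Proof.
move=> cB; split.
- by move=> T [AT _]; exact: cstar_bounded AT.
- by split; [exact: (cstar0 cA)|rewrite /= Phi0; exact: (cstar0 cB)].
- move=> T U [AT BT] [AU BU]; split; split.
  + exact: (cstarD cA).
  + by rewrite /= PhiD//; exact: (cstarD cB).
  + exact: (cstarM cA).
  + by rewrite /= PhiM//; exact: (cstarM cB).
- move=> c T [AT BT]; split; first exact: (cstarZ cA).
  by rewrite /= PhiZ//; exact: (cstarZ cB).
have [_ _ _ _ [Aadj Acl]] := cA; have [_ _ _ _ [Badj Bcl]] := cB.
split=> [T T' [AT BT] TT'|T bT Tlim].
  split; first exact: Aadj AT TT'.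
  exact: Badj BT (Phi_adjoint AT TT').
have AT : A T by apply: Acl => // e e0; have [U [AU _] UT] := Tlim e e0; exists U.
split=> //; apply: Bcl; first exact: Phi_bounded.
move=> e e0; have [U [AU BU] UT] := Tlim e e0; exists (Phi U) => //.
by rewrite -PhiB//; apply: contr => //; [exact: ltW|exact: (cstarB cA)].
Qed.

End Image.

(** * Weighted compositions and the canonical correspondence *)

Section WeightedComposition.
Local Open Scope ring_scope.
Local Open Scope complex_scope.
Variables (R : realType) (X Y : choiceType).

(** Summing over [s] the values of [h \o phi] counts every point of [X] at most
    [N] times. *)
Lemma sum_fibres_le (phi : Y -> X) (h : X -> R) (N : nat) (s : seq Y) :
  (forall x, 0 <= h x) ->
  (forall x, (count (fun y => phi y == x) s <= N)%N) ->
  \sum_(y <- s) h (phi y) <= N%:R * \sum_(x <- undup (map phi s)) h x.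
Proof.
move=> h0 fibN; rewrite -(big_map phi xpredT h) -big_undup_iterop_count mulr_sumr.
apply: ler_sum => x _.
rewrite -[iterop _ _ _ _]/(h x *+ _) -[h x *+ _]mulr_natl ler_wpM2r// ler_nat count_map.
by apply: leq_trans (fibN x); rewrite leq_eqVlt; apply/orP; left; apply/eqP/eq_count.
Qed.

(** All the concrete operators below, multiplications, translations, the
    embedding and the pieces of the adjacency matrix, have this form; they are
    bounded because [phi] is at most [N]-to-one where [g] does not vanish. *)
Lemma exists_weighted_composition (g : Y -> R[i]) (phi : Y -> X) (M : R) (N : nat) :
  0 <= M -> (0 < N)%N -> (forall y, normc (g y) <= M) ->
  (forall x s, uniq s -> (forall y, y \in s -> g y != 0 /\ phi y = x) ->
    (size s <= N)%N) ->
  {W : ell2 R X -> ell2 R Y | linear W /\ norm_le W (M * N%:R) &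
    forall u y, W u y = g y * u (phi y)}.
Proof.
move=> M0 N0 gM fib.
have Wu (u : ell2 R X) : {w : ell2 R Y | ell2_fun w = (fun y => g y * u (phi y)) &
    l2norm w <= M * N%:R * l2norm u}.
  apply: ell2_bound => [|s us]; first by rewrite !mulr_ge0 ?l2norm_ge0.
  set t := [seq y <- s | g y != 0].
  have ut : uniq t by exact: filter_uniq.
  apply: (@le_trans _ _ (M ^+ 2 * \sum_(y <- t) normc (u (phi y)) ^+ 2)).
    rewrite big_filter mulr_sumr [leRHS]big_mkcond/=; apply: ler_sum => y _.
    case: ifPn => [_|/negPn/eqP->]; last by rewrite mul0r normc0 expr0n.
    rewrite normcM exprMn ler_wpM2r ?sqr_ge0// lerXn2r// nnegrE ?normc_ge0//.
  rewrite !exprMn -mulrA ler_wpM2l ?sqr_ge0//.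
  apply: le_trans (@sum_fibres_le phi (fun x => normc (u x) ^+ 2) N t _ _) _.
  - by move=> x; exact: sqr_ge0.
  - move=> x; rewrite -size_filter; apply: (fib x); first exact: filter_uniq.
    by move=> y; rewrite !mem_filter => /and3P[/eqP].
  have := sum_le_l2norm u (undup_uniq (map phi t)).
  set S := \sum_(x <- _) _; have S0 : 0 <= S by apply: sumr_ge0 => x _; exact: sqr_ge0.
  have N1 : 1 <= N%:R :> R by rewrite ler1n.
  move=> Su; apply: ler_pM => //; rewrite expr2.
  by rewrite -[leLHS]mul1r ler_wpM2r// (le_trans ler01).
exists (fun u => s2val (Wu u)) => [|u y]; last by rewrite /= (s2valP (Wu u)).
split=> [c u v|u]; last exact: (s2valP' (Wu u)).
apply: ell2P => y.
rewrite -[RHS]/(c * s2val (Wu u) y + s2val (Wu v) y) !(s2valP (Wu _)).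
by rewrite -[LHS]/(g y * (c * u (phi y) + v (phi y))); ring.
Qed.

Lemma exists_injective_composition (g : Y -> R[i]) (phi : Y -> X) (M : R) :
  0 <= M -> (forall y, normc (g y) <= M) ->
  (forall y z, g y != 0 -> g z != 0 -> phi y = phi z -> y = z) ->
  {W : ell2 R X -> ell2 R Y | linear W /\ norm_le W M &
    forall u y, W u y = g y * u (phi y)}.
Proof.
move=> M0 gM inj; rewrite -[M]mulr1.
apply: (exists_weighted_composition M0 (ltn0Sn 0) gM) => x.
case=> [|y [|z s]]//= /andP[+ _] yz.
have [gy py] := yz y (mem_head _ _).
have [gz pz] : g z != 0 /\ phi z = x by apply: yz; rewrite !inE eqxx orbT.
by rewrite (inj y z gy gz) ?py ?pz// mem_head.
Qed.

End WeightedComposition.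

Section Commutant.
Local Open Scope ring_scope.
Local Open Scope complex_scope.
Variables (R : realType) (X : choiceType) (Q : op R X).

(** [T \o Q - Q \o T] depends continuously on [T], and its adjoint is minus the
    corresponding expression for the adjoint of [T]. *)
Lemma commutant_cstar : bounded_op Q -> adjoint_map Q Q ->
  cstar_subalgebra [set T | bounded_op T /\ T \o Q = Q \o T].
Proof.
move=> bQ QQ; have [lQ _] := bQ; have [M M0 QM] := bounded_map_ge0 bQ.
have cB := bounded_op_cstar R X; split.
- by move=> T [].
- split; first exact: (cstar0 cB).
  by apply/funext => u; rewrite /= -[0 _]/(0) -[(0 : op R X) u]/(0) (linear_0 lQ).
- move=> T U [bT TQ] [bU UQ]; split; split.
  + exact: (cstarD cB).
  + apply/funext => u; have := congr1 (fun f => f u) TQ.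
    have := congr1 (fun f => f u) UQ => /= UQu TQu.
    by rewrite -[(T + U) _]/(T (Q u) + U (Q u)) TQu UQu -(linear_D lQ).
  + exact: (cstarM cB).
  + by rewrite -compA UQ compA TQ.
- move=> c T [bT TQ]; split; first exact: (cstarZ cB).
  apply/funext => u; have := congr1 (fun f => f u) TQ => /= TQu.
  by rewrite -[(c *: T) _]/(c *: T (Q u)) TQu -(linear_Z lQ).
split=> [T T' [bT TQ] [bT' TT']|T bT Tlim].
  split=> //; apply: (@adjoint_map_unique _ _ _ (T \o Q)).
    by move=> u v; rewrite TQ/= QQ TT'.
  by move=> u v; rewrite /= TT' QQ.
split=> //; apply/funext => u; apply/eqP; rewrite -subr_eq0; apply/eqP.
apply/l2norm_eq0/eqP; rewrite eq_le l2norm_ge0 andbT.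
apply: (@le0_of_all_eps _ _ (2 * M * l2norm u)) => e e0.
have [U [bU UQ] TU] := Tlim e e0.
have -> : (T \o Q) u - (Q \o T) u = (T - U) (Q u) - Q ((T - U) u).
  have := congr1 (fun f => f u) UQ => /= UQu.
  rewrite -[(T - U) _]/(T (Q u) - U (Q u)) -[(T - U) u]/(T u - U u).
  by rewrite (linear_B lQ) UQu opprB addrA addrNK.
apply: le_trans (ler_l2normD _ _) _; rewrite l2normN.
have h1 := TU (Q u); have h2 := QM ((T - U) u); have h3 := TU u; have h4 := QM u.
have h5 := ler_wpM2l (ltW e0) h4; have h6 := ler_wpM2l M0 h3.
by move: h1 h2 h5 h6; lra.
Qed.

End Commutant.

Section SemigroupOperators.
Local Open Scope ring_scope.
Local Open Scope complex_scope.
Variables (R : realType) (S : inverseSemigroupType).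
Implicit Types (s x y : S) (f : S -> R[i]).

Lemma linfty_ge0 f : linfty f -> exists2 M, 0 <= M & forall x, normc (f x) <= M.
Proof.
move=> [M fM]; exists `|M| => // x; exact: le_trans (fM x) (ler_norm _).
Qed.

Lemma normc_bool (b : bool) : normc (b%:R : R[i]) <= 1.
Proof. by case: b; rewrite ?normc1 ?normc0. Qed.

(** The translations by [s] and by [istar s] are inverse partial bijections. *)
Lemma star_mul_eq s x y : Ddom (istar s) y /\ (istar s * y)%g = x <->
  Ddom s x /\ y = (s * x)%g.
Proof.
split=> [[sy <-]|[sx ->]].
  by split; [move/Ddom_star: sy|move/DdomP: sy]; rewrite istarK.
by split; [exact: Ddom_star|apply/DdomP].
Qed.

Lemma exists_diag f : linfty f -> exists D, diag_op f D.
Proof.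
move=> /linfty_ge0[M M0 fM].
have [//|D [lD DM] DE] := exists_injective_composition (phi := id) M0 fM.
exists D; split; first by split=> //; exists M.
move=> x; apply: ell2P => y; rewrite DE ell2Z !deltaE.
by have [->|] := eqVneq y x; rewrite ?mulr0.
Qed.

Lemma exists_V s : exists V : op R S, V_op s V.
Proof.
have [||V [lV VM] VE] := @exists_injective_composition R S S
  (fun y => (y \in Ddom (istar s))%:R) (fun y => istar s * y)%g 1 ler01.
- by move=> y; exact: normc_bool.
- move=> y z; rewrite !pnatr_eq0 !eqb0 !negbK => /set_mem sy /set_mem sz yz.
  have [_ ->] := (star_mul_eq s (istar s * y)%g y).1 (conj sy erefl).
  by have [_] := (star_mul_eq s (istar s * y)%g z).1 (conj sz (esym yz)).
exists V; split; first by split=> //; exists 1.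
move=> x; apply: ell2P => y; rewrite VE deltaE.
have [sx|sx] := pselect (Ddom s x); [rewrite (mem_set sx)|rewrite (memNset sx)].
  have [->|yx] := eqVneq y (s * x)%g.
    rewrite mem_set; last exact: Ddom_star.
    by rewrite (DdomP _ _).1// deltaE !eqxx mulr1.
  rewrite deltaE (negbTE yx); have [sy|] := boolP (y \in _); last by rewrite mul0r.
  case: eqP => [e|_]; last by rewrite mulr0.
  have [_ /eqP] := (star_mul_eq s x y).1 (conj (set_mem sy) e).
  by rewrite (negbTE yx).
rewrite ell20; have [sy|] := boolP (y \in _); last by rewrite mul0r.
case: eqP => [e|_]; last by rewrite mulr0.
by have [] := (star_mul_eq s x y).1 (conj (set_mem sy) e).
Qed.

Lemma exists_pi f : linfty f -> exists P, pi_op f P.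
Proof.
move=> /linfty_ge0[M M0 fM].
have [||P [lP PM] PE] := @exists_injective_composition R _ _
  (fun p : S * S => if p.1 \in Ddom p.2 then f (p.2 * p.1)%g else 0) id M M0.
- by move=> p; case: ifP => // _; rewrite normc0.
- by [].
exists P; split; first by split=> //; exists M.
move=> x y; apply: ell2P => p; rewrite PE deltaE.
have [->|pxy] := eqVneq p (x, y).
  by rewrite /= mulr1; case: ifP => // _; rewrite ell2Z deltaE eqxx mulr1.
by rewrite mulr0; case: ifP => // _; rewrite ell2Z deltaE (negbTE pxy) mulr0.
Qed.

Lemma exists_oneV s : exists W : op R (S * S)%type, oneV_op s W.
Proof.
have [||W [lW WM] WE] := @exists_injective_composition R _ _
  (fun p : S * S => (p.2 \in Ddom (istar s))%:R) (fun p => (p.1, istar s * p.2)%g)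
  1 ler01.
- by move=> y; exact: normc_bool.
- move=> [a y] [b z]; rewrite !pnatr_eq0 !eqb0 !negbK /=.
  move=> /set_mem sy /set_mem sz [-> yz]; congr pair.
  have [_ ->] := (star_mul_eq s (istar s * y)%g y).1 (conj sy erefl).
  by have [_] := (star_mul_eq s (istar s * y)%g z).1 (conj sz (esym yz)).
exists W; split; first by split=> //; exists 1.
move=> x y; apply: ell2P => -[a b]; rewrite WE deltaE /= xpair_eqE.
have [sx|sx] := pselect (Ddom s y); [rewrite (mem_set sx)|rewrite (memNset sx)].
  rewrite deltaE xpair_eqE; have [->|yx] := eqVneq b (s * y)%g.
    rewrite mem_set; last exact: Ddom_star.
    by rewrite (DdomP _ _).1// !eqxx mul1r.
  rewrite andbF; have [sy|] := boolP (b \in _); last by rewrite mul0r.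
  case: eqP => [_|_]; last by rewrite mulr0.
  case: eqP => [e|_]; last by rewrite mulr0.
  have [_ /eqP] := (star_mul_eq s y b).1 (conj (set_mem sy) e).
  by rewrite (negbTE yx).
rewrite ell20; have [sy|] := boolP (b \in _); last by rewrite mul0r.
case: eqP => [_|_]; last by rewrite mulr0.
case: eqP => [e|_]; last by rewrite mulr0.
by have [] := (star_mul_eq s y b).1 (conj (set_mem sy) e).
Qed.

Lemma pi_oneV_delta f s (P W : op R (S * S)%type) x y : pi_op f P -> oneV_op s W ->
  Ddom s y -> (P \o W) (delta R (x, y)) =
    if x \in Ddom (s * y)%g then f (s * y * x)%g *: delta R (x, (s * y)%g) else 0.
Proof. by move=> [_ PE] [_ WE] sy; rewrite /= WE mem_set// PE. Qed.

Lemma pi_oneV_delta0 f s (P W : op R (S * S)%type) x y : pi_op f P -> oneV_op s W ->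
  ~ Ddom s y -> (P \o W) (delta R (x, y)) = 0.
Proof. by move=> [[lP _] PE] [_ WE] sy; rewrite /= WE memNset// (linear_0 lP). Qed.

Lemma diag_V_delta f s (D V : op R S) x : diag_op f D -> V_op s V ->
  (D \o V) (delta R x) =
    if x \in Ddom s then f (s * x)%g *: delta R (s * x)%g else 0.
Proof.
move=> [[lD _] DE] [_ VE]; rewrite /= VE; case: ifP => _; first by rewrite DE.
exact: linear_0 lD.
Qed.

(** The isometry [J : delta y |-> delta (y^* y) (x) delta y].  The span of these
    vectors reduces the crossed product, since [y |-> s y] does not change [y^* y]
    on the domain of [s].  There the condition that [y^* y] belongs to the domain
    of [y] is always satisfied and [f (y (y^* y)) = f y], so the crossed product
    acts as the algebra generated by the [f V_s]. *)
Lemma exists_embedding :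
  exists (J : ell2 R S -> ell2 R (S * S)%type) (Js : ell2 R (S * S)%type -> ell2 R S),
  [/\ bounded_map J /\ norm_le J 1, bounded_map Js /\ norm_le Js 1,
      adjoint_map J Js,
      forall y, J (delta R y) = delta R ((istar y * y)%g, y) &
      forall x y, Js (delta R (x, y)) = if x == (istar y * y)%g then delta R y else 0].
Proof.
have [||J [lJ JM] JE] := @exists_injective_composition R _ _
  (fun p : S * S => (p.1 == istar p.2 * p.2)%g%:R) (fun p => p.2) 1 ler01.
- by move=> y; exact: normc_bool.
- move=> [a y] [b z]; rewrite !pnatr_eq0 !eqb0 !negbK /= => /eqP-> /eqP-> yz.
  by rewrite yz.
have [||Js [lJs JsM] JsE] := @exists_injective_composition R _ _
  (fun y : S => 1) (fun y => (istar y * y, y)%g) 1 ler01.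
- by move=> y; rewrite normc1.
- by move=> y z _ _ [].
have Jd y : J (delta R y) = delta R ((istar y * y)%g, y).
  apply: ell2P => -[a b]; rewrite JE !deltaE xpair_eqE /=.
  have [->|] := eqVneq b y; last by rewrite mulr0 andbF.
  by rewrite mulr1 andbT.
exists J, Js; split=> //.
- by split=> //; split=> //; exists 1.
- by split=> //; split=> //; exists 1.
- apply: adjoint_of_delta; first by split=> //; exists 1.
  by move=> y v; rewrite Jd inner_delta JsE mul1r.
move=> x y; apply: ell2P => b; rewrite JsE mul1r deltaE xpair_eqE.
have [->|bx] := eqVneq b y.
  by rewrite andbT eq_sym; case: ifP; rewrite // deltaE eqxx.
by rewrite andbF; case: ifP; rewrite // deltaE (negbTE bx).
Qed.

Lemma crossed_generators_bounded :
  [set T | exists f s P W,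
    [/\ linfty f, pi_op f P, oneV_op s W & T = P \o W]] `<=` @bounded_op R (S * S)%type.
Proof.
move=> _ [f [s [P [W [_ [bP _] [bW _] ->]]]]].
exact: (cstarM (bounded_op_cstar R (S * S)%type)).
Qed.

Lemma RS_generators_bounded :
  [set T | exists f s D V,
    [/\ linfty f, diag_op f D, V_op s V & T = D \o V]] `<=` @bounded_op R S.
Proof.
move=> _ [f [s [P [W [_ [bP _] [bW _] ->]]]]].
exact: (cstarM (bounded_op_cstar R S)).
Qed.

Lemma crossed_product_cstar : cstar_subalgebra (crossed_product R S).
Proof. exact/cstar_generated_cstar/crossed_generators_bounded. Qed.

Lemma RS_cstar : cstar_subalgebra (RS R S).
Proof. exact/cstar_generated_cstar/RS_generators_bounded. Qed.

(** The compression [T |-> J^* T J] is multiplicative on the commutant of the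
    projection [J J^*], which contains the crossed product. *)
Lemma exists_canonical_correspondence :
  exists2 Phi, canonical_correspondence Phi &
    forall T (e : R), 0 <= e -> crossed_product R S T -> norm_le T e ->
      norm_le (Phi T) e.
Proof.
have [J [Js [[bJ J1] [bJs Js1] JJs Jd Jsd]]] := exists_embedding.
have [[lJ _] [lJs _]] := (bJ, bJs).
have bQ : bounded_op (J \o Js).
  split=> [c u v|]; first by rewrite /= lJs lJ.
  by exists 1 => u /=; apply: (le_trans (J1 _)); rewrite mul1r; exact: Js1.
have QQ : adjoint_map (J \o Js) (J \o Js).
  by move=> u v /=; rewrite JJs -(adjoint_map_sym JJs).
have Qd x y : J (Js (delta R (x, y))) =
    if x == (istar y * y)%g then delta R (x, y) else 0.
  by rewrite Jsd; case: eqP => [->|_]; rewrite ?Jd ?(linear_0 lJ).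
have cQ := commutant_cstar bQ QQ.
have crossQ : crossed_product R S `<=`
    [set T | bounded_op T /\ T \o (J \o Js) = (J \o Js) \o T].
  apply: cstar_generated_sub => //.
  move=> T Tgen; have bT := crossed_generators_bounded Tgen; split=> //.
  have cB := bounded_op_cstar R (S * S)%type.
  apply: eq_on_delta; [exact: (cstarM cB)|exact: (cstarM cB)|move=> [x y]].
  have [lT _] := bT; case: Tgen => f [s [P [W [_ fP sW TE]]]].
  rewrite /= Qd TE; have [sy|sy] := pselect (Ddom s y).
    rewrite [in RHS](pi_oneV_delta x fP sW sy).
    have -> : (x == istar y * y)%g = (x == istar (s * y) * (s * y))%g.
      by have := Ddom_Lrel sy; rewrite /Lrel => ->.
    case: eqP => xsy.
      rewrite (pi_oneV_delta x fP sW sy); case: ifP => _.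
        by rewrite (linear_Z lJs) (linear_Z lJ) Qd xsy eqxx.
      by rewrite (linear_0 lJs) (linear_0 lJ).
    rewrite -TE (linear_0 lT); case: ifP => _.
      by rewrite (linear_Z lJs) (linear_Z lJ) Qd; case: eqP => // _; rewrite scaler0.
    by rewrite (linear_0 lJs) (linear_0 lJ).
  rewrite [in RHS](pi_oneV_delta0 x fP sW sy) (linear_0 lJs) (linear_0 lJ).
  case: eqP => _; last by rewrite -TE (linear_0 lT).
  by rewrite (pi_oneV_delta0 x fP sW sy).
have JsJ u : Js (J u) = u.
  have : Js \o J = id; last by move=> /(congr1 (fun h => h u)).
  apply: eq_on_delta => [||x]; last by rewrite /= Jd Jsd eqxx.
    split=> [c a b|]; first by rewrite /= lJ lJs.
    by exists 1 => a /=; apply: (le_trans (Js1 _)); rewrite mul1r; exact: J1.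
  by split=> //; exists 1 => a; rewrite mul1r.
pose Phi (T : op R (S * S)%type) : op R S := Js \o T \o J.
have contr T (e : R) : 0 <= e -> norm_le T e -> norm_le (Phi T) e.
  move=> e0 Te u; apply: (le_trans (Js1 _)); rewrite mul1r.
  apply: (le_trans (Te _)); rewrite ler_wpM2l//.
  by apply: (le_trans (J1 _)); rewrite mul1r.
have Phi_bounded T : bounded_op T -> bounded_op (Phi T).
  move=> bT; have [lT _] := bT; have [M M0 TM] := bounded_map_ge0 bT.
  split; last by exists M; exact: contr.
  by move=> c u v; rewrite /Phi /= lJ lT lJs.
have cC := crossed_product_cstar.
exists Phi; last by move=> T e e0 _; exact: contr.
split.
  split.
  - by move=> T /(cstar_bounded cC)/Phi_bounded.
  - by move=> T U _ _; apply/funext => u; exact: (linear_D lJs).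
  - by move=> c T _; apply/funext => u; exact: (linear_Z lJs).
  - move=> T U _ /crossQ[_ UQ]; apply/funext => u.
    have := congr1 (fun h => h (J u)) UQ => /= UQJ.
    by rewrite /Phi /= -UQJ JsJ.
  - move=> T T' CT [bT' TT']; split; first exact: Phi_bounded.
    by move=> u v; rewrite /Phi /= -JJs -TT' -(adjoint_map_sym JJs).
move=> f s P W D V lf fP sW fD sV.
have gPW : crossed_product R S (P \o W).
  by apply: sub_cstar_generated; exists f, s, P, W.
have gDV : RS R S (D \o V) by apply: sub_cstar_generated; exists f, s, D, V.
apply: eq_on_delta.
- exact: Phi_bounded (cstar_bounded cC gPW).
- exact: (cstar_bounded RS_cstar gDV).
move=> y; rewrite (diag_V_delta y fD sV) /Phi.
rewrite -[LHS]/(Js ((P \o W) (J (delta R y)))) Jd.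
have [sy|sy] := pselect (Ddom s y); last first.
  by rewrite (pi_oneV_delta0 _ fP sW sy) (memNset sy) (linear_0 lJs).
rewrite (pi_oneV_delta _ fP sW sy) (mem_set sy).
have Ly : (istar (s * y) * (s * y) = istar y * y)%g by exact/esym/Ddom_Lrel.
rewrite mem_set; last by rewrite /Ddom/= Ly idem_star_mul.
by rewrite (linear_Z lJs) Jsd Ly eqxx -mulgA [(y * _)%g]mulgA mulg_istarK.
Qed.

End SemigroupOperators.

(** * Finite labelings and bounded propagation *)

Section ClosureCstar.
Local Open Scope ring_scope.
Local Open Scope complex_scope.
Variables (R : realType) (X : choiceType) (G : set (op R X)).
Hypotheses (G_bounded : G `<=` @bounded_op R X) (G0 : G 0).
Hypotheses (GD : forall T U, G T -> G U -> G (T + U))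
  (GM : forall T U, G T -> G U -> G (T \o U))
  (GZ : forall (c : R[i]) T, G T -> G (c *: T))
  (G_adjoint : forall T T', G T -> adjoint T T' -> G T').
Implicit Types (T U : op R X).

Lemma mul_div_succ_le (a b : R) : 0 <= a -> 0 <= b -> a * (b / (a + 1)) <= b.
Proof.
by move=> a0 b0; rewrite mulrA ler_pdivrMr ?ltr_wpDl// mulrC ler_wpM2l// lerDl.
Qed.

(** Turns closure properties of explicit operators into approximations of the
    elements of a generated C*-algebra. *)
Lemma closure_cstar : cstar_subalgebra
  [set T | bounded_op T /\
    forall e : R, 0 < e -> exists2 U, G U & norm_le (T - U) e].
Proof.
have cB := bounded_op_cstar R X; split.
- by move=> T [].
- split; first exact: (cstar0 cB).
  move=> e e0; exists 0 => // u; rewrite subrr -[(0 : op R X) u]/(0) l2norm0.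
  by rewrite mulr_ge0 ?l2norm_ge0// ltW.
- move=> T T1 [bT Tlim] [bT1 T1lim]; split; split.
  + exact: (cstarD cB).
  + move=> e e0; have e20 : 0 < e / 2 by rewrite divr_gt0.
    have [U GU TU] := Tlim _ e20; have [U1 GU1 TU1] := T1lim _ e20.
    exists (U + U1); first exact: GD.
    rewrite opprD addrACA [e](splitr e); exact: norm_leD.
  + exact: (cstarM cB).
  + move=> e e0; have [M M0 TM] := bounded_map_ge0 bT.
    have d0 : 0 < e / 2 / (M + 1) by rewrite !divr_gt0// ltr_wpDl.
    have [U1 GU1 TU1] := T1lim _ d0.
    have [N N0 UN] := bounded_map_ge0 (G_bounded GU1).
    have d'0 : 0 < e / 2 / (N + 1) by rewrite !divr_gt0// ltr_wpDl.
    have [U GU TU] := Tlim _ d'0.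
    exists (U \o U1); first exact: GM.
    have [lT _] := bT.
    have -> : (T \o T1) - (U \o U1) = (T \o (T1 - U1)) + ((T - U) \o U1).
      apply/funext => u.
      rewrite -[LHS]/(T (T1 u) - U (U1 u)).
      rewrite -[RHS]/(T (T1 u - U1 u) + (T (U1 u) - U (U1 u))).
      by rewrite (linear_B lT) addrA addrNK.
    have h1 := norm_le_comp M0 TM TU1; have h2 := norm_le_comp (ltW d'0) TU UN.
    apply: norm_le_weaken (norm_leD h1 h2); rewrite [e in leRHS](splitr e).
    have e20 : 0 <= e / 2 by rewrite divr_ge0// ltW.
    by apply: lerD; [|rewrite mulrC]; exact: mul_div_succ_le.
- move=> c T [bT Tlim]; split; first exact: (cstarZ cB).
  move=> e e0; have c1 : 0 < normc c + 1 by rewrite ltr_wpDl ?normc_ge0.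
  have d0 : 0 < e / (normc c + 1) by rewrite divr_gt0.
  have [U GU TU] := Tlim _ d0; exists (c *: U); first exact: GZ.
  rewrite -scalerBr; apply: norm_le_weaken (norm_leZ c TU).
  by apply: mul_div_succ_le; rewrite ?normc_ge0// ltW.
split=> [T T' [bT Tlim] [bT' TT']|T bT Tlim].
  split; first exact: bT'.
  move=> e e0; have [U GU TU] := Tlim e e0.
  have [U' bU' UU'] := exists_adjoint (G_bounded GU).
  exists U'; first exact: G_adjoint GU (conj bU' UU').
  apply: adjoint_map_norm (ltW e0) _ TU => u v.
  rewrite -[(T - U) u]/(T u - U u) -[(T' - U') v]/(T' v - U' v).
  by rewrite innerBl innerBr TT' UU'.
split=> // e e0; have e20 : 0 < e / 2 by rewrite divr_gt0.
have [T1 [_ T1lim] TT1] := Tlim _ e20; have [U GU TU] := T1lim _ e20.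
exists U => //; rewrite [e](splitr e) -(subrK T1 T) -addrA.
exact: norm_leD.
Qed.

End ClosureCstar.

Section Propagation.
Local Open Scope ring_scope.
Local Open Scope complex_scope.
Variables (R : realType) (S : inverseSemigroupType) (K : set S).
Implicit Types (s w x y : S) (T U : op R S) (ws : seq S).

Lemma walk_dist n x y : walk K n x y -> (path_dist R K x y <= (n%:R)%:E)%E.
Proof. by move=> xy; apply: ereal_inf_lbound; exists n. Qed.

Lemma dist_walk (r : R) : exists N, forall x y,
  (path_dist R K x y <= r%:E)%E -> exists2 n, (n <= N)%N & walk K n x y.
Proof.
exists (Num.Def.archi_bound (`|r| + 1)) => x y xy.
have : (path_dist R K x y < (`|r| + 1)%:E)%E.
  apply: le_lt_trans xy _; rewrite lte_fin.
  by rewrite (le_lt_trans (ler_norm r))// ltrDl.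
move=> /ereal_inf_lt[_ [n xyn <-]]; rewrite lte_fin => nr; exists n => //.
rewrite ltnW// -(ltr_nat R); apply: lt_trans nr _.
by apply: archi_boundP; rewrite addr_ge0.
Qed.

Lemma RS_sub_roe : generates K -> RS R S `<=` uniform_roe (path_dist R K).
Proof.
move=> genK; apply: cstar_generated_sub.
  by apply: cstar_generated_cstar => T [].
move=> T gT; apply: sub_cstar_generated; split; first exact: RS_generators_bounded.
case: gT => f [s [D [V [_ fD sV ->]]]]; have [p sp] := genK s.
exists p%:R => x y; rewrite inner_delta (diag_V_delta x fD sV).
case: ifPn => [/set_mem sx|_]; last by rewrite ell20 eqxx.
rewrite -[_ y]/(f (s * x)%g * delta R (s * x)%g y) deltaE.
have [-> _|] := eqVneq y (s * x)%g; last by rewrite mulr0 eqxx.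
exact/walk_dist/words_walk.
Qed.

(** Every vertex [x] lies on a closed walk, since [k * istar k] fixes [x] when
    [k] is the first letter of a word for [x]. *)
Lemma return_walk x : symmetric_set K -> generates K -> walk K 2 x x.
Proof.
move=> symK genK; have [p [k [w [Kw _ xE]]]] := genK x.
have Kk : K k by apply: Kw; rewrite mem_head.
have kx : Ddom (istar k) x.
  apply/DdomP; rewrite istarK xE => {xE Kw}.
  elim/last_ind: w => [|w v IHw]; first by rewrite /= mulgA mulg_istarK.
  by rewrite foldl_rcons -[in RHS]IHw !mulgA.
have xkx : edge K x (istar k * x)%g.
  by split; [exact: Ddom_Lrel|exists (istar k) => //; exact: symK].
by exists (istar k * x)%g => //; exists x => //; exact: edge_sym.
Qed.

Lemma labeled_walk (C : nat) (K1 : set S) n x y :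
  (forall x y, Lrel x y -> (exists2 k, K k & (k * x = y)%g) ->
    exists p, (1 <= p <= C)%N /\ exists2 w, words K1 p w & (w * x = y)%g) ->
  walk K n.+1 x y ->
  exists p, (1 <= p <= n.+1 * C)%N /\ exists2 w, words K1 p w & (w * x = y)%g.
Proof.
move=> lab; elim: n x => [|n IHn] x [z [xz xkz] zy].
  by rewrite mul1n -zy; exact: lab.
have [p [/andP[p1 pC] [w Kw wx]]] := lab _ _ xz xkz.
have [q [/andP[q1 qC] [v Kv vz]]] := IHn _ zy.
exists (q + p)%N; split; first by rewrite addn_gt0 q1/= mulSn addnC leq_add.
by exists (v * w)%g; [exact: wordsM|rewrite -mulgA wx].
Qed.

(** Each edge of a walk is a word of length at most [C] in the finite set [K1],
    and there are finitely many words of bounded length.  The walk of length [0]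
    is replaced by a closed walk of length [2], as there is no empty word. *)
Lemma labeling_elements (r : R) : symmetric_set K -> generates K ->
  finite_labeling K -> exists2 ws, uniq ws & forall x y,
    (path_dist R K x y <= r%:E)%E ->
    exists s, [/\ s \in ws, Ddom s x & (s * x = y)%g].
Proof.
move=> symK genK [C [K1 [C1 K1K finK1 lab]]].
have [N NP] := dist_walk r.
pose F := \bigcup_(p in `I_(N.+2 * C).+1) words K1 p.
have finF : finite_set F.
  by apply: bigcup_finite; [exact: finite_II|move=> p _; exact: finite_words].
exists (finmap.enum_fset (fset_set F)); first exact: finmap.fset_uniq.
move=> x y /NP[n nN xy].
have {}xy : exists2 n', (n' <= N.+1)%N & walk K n'.+1 x y.
  case: n nN xy => [_ /= <-|n nN xy]; first by exists 1%N => //; exact: return_walk.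
  by exists n => //; rewrite ltnW// ltnW.
have [{nN}n nN {}xy] := xy.
have [p [/andP[p1 pC] [w Kw wx]]] := labeled_walk lab xy.
exists w; split=> //; last by apply: Lrel_Ddom; rewrite wx; exact: walk_Lrel xy.
rewrite in_fset_set//; apply/mem_set; exists p => //=.
by rewrite ltnS (leq_trans pC)// leq_mul2r ltnS nN orbT.
Qed.

Lemma op_sum (I : Type) (s : seq I) (F : I -> op R S) u :
  (\sum_(i <- s) F i) u = \sum_(i <- s) F i u.
Proof.
elim: s => [|i s IHs]; first by rewrite !big_nil.
by rewrite !big_cons -IHs.
Qed.

(** A bounded operator whose matrix is supported on finitely many graphs
    [y = s x] is the sum of operators [f_s V_s]: each matrix entry is attributed
    to one element [c x y] of the list, and [f_s] collects the entries attributed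
    to [s]. *)
Lemma finite_graphs_RS T ws : uniq ws -> bounded_op T ->
  (forall x y, T (delta R x) y != 0 ->
    exists s, [/\ s \in ws, Ddom s x & (s * x = y)%g]) ->
  RS R S T.
Proof.
move=> uws bT Tws; have [M M0 TM] := bounded_map_ge0 bT.
have Tc (p : S * S) : exists s, T (delta R p.1) p.2 != 0 ->
    [/\ s \in ws, Ddom s p.1 & (s * p.1 = p.2)%g].
  have [/Tws[s sP]|Tp] := boolP (T (delta R p.1) p.2 != 0); first by exists s.
  by exists p.1.
have [c cP] := choice Tc.
pose f s y := if c ((istar s * y)%g, y) == s
  then T (delta R (istar s * y)%g) y else 0.
have fb s : linfty (f s).
  exists M => y; rewrite /f; case: ifP => _; last by rewrite normc0.
  apply: le_trans (coord_le_l2norm _ _) _.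
  by apply: le_trans (TM _) _; rewrite l2norm_delta mulr1.
have [D DP] := choice (fun s => exists_diag (fb s)).
have [V VP] := choice (@exists_V R S).
have gen s : RS R S (D s \o V s).
  by apply: sub_cstar_generated; exists (f s), s, (D s), (V s).
have sumRS : RS R S (\sum_(s <- ws) (D s \o V s)).
  by apply: cstar_sum (RS_cstar R S) _ _ _ _ => s _; exact: gen.
rewrite (_ : T = \sum_(s <- ws) (D s \o V s))//.
apply: eq_on_delta => // [|x]; first exact: (cstar_bounded (RS_cstar R S) sumRS).
apply: ell2P => y; rewrite op_sum ell2_sum.
have term s : (D s \o V s) (delta R x) y =
    if (T (delta R x) y != 0) && (c (x, y) == s) then T (delta R x) y else 0.
  rewrite (diag_V_delta x (DP s) (VP s)).
  have [sx|sx] := pselect (Ddom s x); last first.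
    rewrite (memNset sx) ell20; case: ifP => // /andP[Txy /eqP cs].
    by have [_] := cP (x, y) Txy; rewrite cs.
  rewrite (mem_set sx) -[LHS]/(f s (s * x)%g * delta R (s * x)%g y) deltaE.
  have [->|yx] := eqVneq y (s * x)%g; last first.
    rewrite mulr0; case: ifP => // /andP[Txy /eqP cs].
    by have [_ _ /eqP] := cP (x, y) Txy; rewrite cs /= eq_sym (negbTE yx).
  rewrite mulr1 /f ((DdomP _ _).1 sx).
  by have [->|_] /= := eqVneq (T (delta R x) (s * x)%g) 0; first case: ifP.
under eq_bigr do rewrite term.
have [->|Txy] := eqVneq (T (delta R x) y) 0; first by rewrite big1.
have [cws _ _] := cP (x, y) Txy.
rewrite (bigD1_seq (c (x, y)))//= eqxx big1 ?addr0// => s.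
by rewrite eq_sym => /negbTE->.
Qed.

Lemma roe_sub_RS : symmetric_set K -> generates K -> finite_labeling K ->
  uniform_roe (path_dist R K) `<=` RS R S.
Proof.
move=> symK genK lab; apply: cstar_generated_sub; first exact: RS_cstar.
move=> T [bT [r Tr]].
have [ws uws wsP] := labeling_elements r symK genK lab.
apply: finite_graphs_RS uws bT _ => x y Txy; apply: wsP; apply: Tr.
by rewrite inner_delta.
Qed.

(** The finite sums of operators [f_s V_s], recognized on their matrices. *)
Definition controlled : set (op R S) := [set T | bounded_op T /\
  exists ws, forall x y, T (delta R x) y != 0 ->
    exists s, [/\ s \in ws, Ddom s x & (s * x = y)%g]].

Lemma controlled_closure_cstar : cstar_subalgebra
  [set T | bounded_op T /\
    forall e : R, 0 < e -> exists2 U, controlled U & norm_le (T - U) e].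
Proof.
have cB := bounded_op_cstar R S; apply: closure_cstar.
- by move=> T [].
- split; first exact: (cstar0 cB).
  by exists [::] => x y; rewrite -[X in ell2_fun X]/(0) ell20 eqxx.
- move=> T U [bT [ws wsP]] [bU [vs vsP]]; split; first exact: (cstarD cB).
  exists (ws ++ vs) => x y.
  rewrite -[X in X != 0]/(T (delta R x) y + U (delta R x) y).
  have [->|/wsP[s [sw sx sy]] _] := eqVneq (T (delta R x) y) 0.
    by rewrite add0r => /vsP[s [sw sx sy]]; exists s; rewrite mem_cat sw orbT.
  by exists s; rewrite mem_cat sw.
- move=> T U [bT [ws wsP]] [bU [vs vsP]]; split; first exact: (cstarM cB).
  exists [seq (s * t)%g | s <- ws, t <- vs] => x y /= /(coord_neq0 bT)[z [Uz Tz]].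
  have [t [tv tx tz]] := vsP _ _ Uz; have [s [sw sz sy]] := wsP _ _ Tz.
  exists (s * t)%g; split; first exact: allpairs_f.
    by apply/DdomM; rewrite tz.
  by rewrite -mulgA tz.
- move=> c T [bT [ws wsP]]; split; first exact: (cstarZ cB).
  exists ws => x y; rewrite -[X in X != 0]/(c * T (delta R x) y) mulf_eq0 negb_or.
  by move=> /andP[_ /wsP].
move=> T T' [bT [ws wsP]] [bT' TT']; split=> //.
exists (map (@istar S) ws) => x y.
rewrite -inner_delta -TT' innerC inner_delta conjC_eq0 => /wsP[s [sw sy <-]].
exists (istar s); split; first exact: map_f.
  exact: Ddom_star.
exact/DdomP.
Qed.

Lemma RS_controlled T (e : R) : RS R S T -> 0 < e ->
  exists2 U, controlled U & norm_le (T - U) e.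
Proof.
move=> RT e0; suff /(_ _ RT)[_ h] : RS R S `<=` [set T | bounded_op T /\
    forall e : R, 0 < e -> exists2 U, controlled U & norm_le (T - U) e] by exact: h.
apply: cstar_generated_sub; first exact: controlled_closure_cstar.
move=> U gU; have bU := RS_generators_bounded gU; split=> // d d0.
exists U; last first.
  by move=> u; rewrite subrr l2norm0 mulr_ge0 ?l2norm_ge0// ltW.
split=> //; case: gU => f [s [D [V [_ fD sV ->]]]].
exists [:: s] => x y; rewrite (diag_V_delta x fD sV).
case: ifPn => [/set_mem sx|_]; last by rewrite ell20 eqxx.
rewrite -[_ y]/(f (s * x)%g * delta R (s * x)%g y) deltaE.
have [-> _|] := eqVneq y (s * x)%g; last by rewrite mulr0 eqxx.
by exists s; rewrite mem_head.
Qed.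

Lemma edge_dist x y : edge K x y -> (path_dist R K x y <= 1%:E)%E.
Proof. by move=> xy; apply: (@walk_dist 1); exists y. Qed.

(** Bounded geometry bounds the rows and the columns of the adjacency matrix,
    which is therefore a finite sum of weighted compositions: the [i]-th one reads
    the value at the [i]-th neighbour. *)
Lemma exists_adjacency : symmetric_set K -> bounded_geometry (path_dist R K) ->
  exists2 T, uniform_roe (path_dist R K) T &
    forall x y, edge K x y -> T (delta R x) y = 1.
Proof.
move=> symK bg; have [N NP] := bg 1 ltr01.
have fin_nbrs y : finite_set [set x | edge K y x].
  apply: (@sub_finite_set _ _ [set x | (path_dist R K y x <= 1%:E)%E]).
    by move=> x; exact: edge_dist.
  by apply/finite_set_leP; exists N; exact: NP.
pose nb y : seq S := finmap.enum_fset (fset_set [set x | edge K y x]).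
have nbP x y : (x \in nb y) <-> edge K y x.
  by rewrite in_fset_set//; split=> [/set_mem|/mem_set].
have unb y : uniq (nb y) by exact: finmap.fset_uniq.
have small x (s : seq S) : uniq s -> (forall y, y \in s -> edge K x y) ->
      (size s <= N)%N.
  move=> us sx; apply: leq_trans (uniq_leq_size us (s2 := nb x) _) _.
    by move=> y /sx/nbP.
  apply: geq_card_fset_set; apply: card_le_trans (NP x).
  by apply: subset_card_le => y; exact: edge_dist.
(* [N.+1] rather than [N], as the bound has to be positive. *)
have W (i : nat) : {W : op R S | linear W /\ norm_le W (1 * N.+1%:R) &
    forall u y, W u y = (i < size (nb y))%N%:R * u (nth y (nb y) i)}.
  apply: exists_weighted_composition => // [y|x s us sx]; first exact: normc_bool.
  rewrite leqW//; apply: (small x) => // y /sx[].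
  rewrite pnatr_eq0 eqb0 negbK => iy nx.
  by apply: (edge_sym symK); apply/nbP; rewrite -nx mem_nth.
pose T : op R S := \sum_(0 <= i < N) s2val (W i).
have Td x y : T (delta R x) y = (x \in nb y)%:R.
  rewrite /T op_sum ell2_sum.
  under eq_bigr do rewrite (s2valP' (W _)) deltaE.
  have [xy|xy] := boolP (x \in nb y).
    have iN : (index x (nb y) < N)%N.
      apply: leq_trans (small y _ (unb y) _); first by rewrite index_mem.
      by move=> z /nbP.
    rewrite (bigD1_seq (index x (nb y))) ?iota_uniq//=; last first.
      by rewrite mem_index_iota.
    rewrite index_mem xy nth_index// eqxx mulr1 big1 ?addr0// => i ix.
    case: (ltnP i (size (nb y))) => [iy|]; last by rewrite mul0r.
    case: eqP => [e|_]; last by rewrite mulr0.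
    by rewrite -e index_uniq ?eqxx in ix.
  rewrite big1// => i _; case: (ltnP i (size (nb y))) => [iy|]; last by rewrite mul0r.
  case: eqP => [e|_]; last by rewrite mulr0.
  by rewrite -e mem_nth in xy.
exists T; last by move=> x y /(edge_sym symK)/nbP xy; rewrite Td xy.
apply: sub_cstar_generated; split.
  apply: (cstar_sum (bounded_op_cstar R S)) => i _.
  by have [lW WN] := s2valP (W i); split=> //; exists (1 * N.+1%:R).
exists 1 => x y; rewrite inner_delta Td.
case: (boolP (x \in nb y)); last by rewrite eqxx.
by move=> /nbP/(edge_sym symK)/edge_dist.
Qed.

Lemma words_mono (A B : set S) p s : A `<=` B -> words A p s -> words B p s.
Proof. by move=> AB [k [w [Aw sz ->]]]; exists k, w; split=> // a /Aw/AB. Qed.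

Lemma finite_letters ws : generates K -> exists C K1,
  [/\ (1 <= C)%N, K1 `<=` K, finite_set K1 & forall s, s \in ws ->
    exists2 p, (1 <= p <= C)%N & words K1 p s].
Proof.
move=> genK; elim: ws => [|s ws [C [K1 [C1 K1K finK1 IHws]]]].
  by exists 1%N, set0; split.
have [p [k [w [Kw szw sE]]]] := genK s.
exists (C + p)%N, (K1 `|` [set` k :: w]); split.
- by rewrite addn_gt0 C1.
- by move=> a [/K1K//|/=]; exact: Kw.
- by rewrite finite_setU; split.
move=> t; rewrite inE => /orP[/eqP->|/IHws[q /andP[q1 qC] tq]].
  exists p; first by rewrite -{1}szw/= leq_addl.
  by exists k, w; split=> // a aw; right.
exists q; first by rewrite q1 (leq_trans qC)// leq_addr.
by apply: words_mono tq => a; left.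
Qed.

(** An operator of the form [sum_i f_i V_(s_i)] close to the adjacency operator
    has a nonzero entry at every edge, so that each edge is the action of one of
    the finitely many [s_i]. *)
Lemma RS_finite_labeling : symmetric_set K -> generates K ->
  bounded_geometry (path_dist R K) ->
  uniform_roe (path_dist R K) `<=` RS R S -> finite_labeling K.
Proof.
move=> symK genK bg roeRS; have [T /roeRS RT Td] := exists_adjacency symK bg.
have half : 0 < 1 / 2 :> R by rewrite divr_gt0.
have [U [bU [ws wsP]] TU] := RS_controlled RT half.
have [C [K1 [C1 K1K finK1 K1P]]] := finite_letters ws genK.
exists C, K1; split=> // x y xy kxy.
have Txy := Td x y (conj xy kxy).
have [|s [sw sx sy]] := wsP x y.
  apply/eqP => U0; have := TU (delta R x); rewrite l2norm_delta mulr1.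
  move=> /(le_trans (coord_le_l2norm _ y)).
  rewrite -[_ y]/(T (delta R x) y - U (delta R x) y) Txy U0 subr0 normc1; lra.
by have [p pC sp] := K1P s sw; exists p; split=> //; exists s.
Qed.

End Propagation.

(** * The equivalence *)

Theorem theorem1 (R : realType) (S : inverseSemigroupType) (K : set S)
    (S_countable : countable [set: S])
    (K_symmetric : symmetric_set K)
    (K_generates : generates K)
    (bdd_geom : bounded_geometry (path_dist R K)) :
  finite_labeling K <->
  exists Phi : op R (S * S)%type -> op R S,
    [/\ canonical_correspondence Phi,
        RS R S = Phi @` crossed_product R S &
        Phi @` crossed_product R S = uniform_roe (path_dist R K)].
Proof.
split=> [lab|[Phi [_ RSE roeE]]]; last first.
  by apply: (RS_finite_labeling (R := R)) => //; rewrite RSE roeE.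
have [Phi canPhi contr] := exists_canonical_correspondence R S.
have [homPhi PhiE] := canPhi.
have cC := crossed_product_cstar R S.
have RSE : RS R S = Phi @` crossed_product R S.
  apply/seteqP; split.
    apply: cstar_generated_sub; first exact: image_cstar cC homPhi contr.
    move=> _ [f [s [D [V [lf fD sV ->]]]]].
    have [P fP] := exists_pi lf; have [W sW] := exists_oneV R s.
    exists (P \o W); last exact: PhiE lf fP sW fD sV.
    by apply: sub_cstar_generated; exists f, s, P, W.
  have sub : crossed_product R S `<=` crossed_product R S `&` Phi @^-1` RS R S.
    apply: cstar_generated_sub.
      exact: (preimage_cstar cC homPhi contr (RS_cstar R S)).
    move=> _ [f [s [P [W [lf fP sW ->]]]]].
    have [D fD] := exists_diag lf; have [V sV] := exists_V R s.
    split; first by apply: sub_cstar_generated; exists f, s, P, W.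
    rewrite /= (PhiE f s P W D V)//.
    by apply: sub_cstar_generated; exists f, s, D, V.
  by move=> _ [T /sub[_ RT] <-].
exists Phi; split=> //; rewrite -RSE; apply/seteqP; split.
  exact: RS_sub_roe.
exact: roe_sub_RS.
Qed.
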